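(* There is a randomized protocol in the coordinator model which, with constant probability, returns a $(1+\epsilon)$-approximate solution to the distributed $\ell_1$ regression problem, using $\tilde{O}(sd^3L/\epsilon)$ bits of communication.
   Context: Distributed $\ell_1$ regression: $s$ servers $P_1,\dots,P_s$ and a coordinator; server $P_i$ holds $A^{(i)}\in\mathbb{R}^{n_i\times d}$ and $b^{(i)}\in\mathbb{R}^{n_i}$ with all entries $L$-bit integers; $A\in\mathbb{R}^{n\times d}$ and $b\in\mathbb{R}^n$ are the vertical stackings, $n=\sum_i n_i$. A $(1+\epsilon)$-approximate solution is $x\in\mathbb{R}^d$ with $\|Ax-b\|_1 \le (1+\epsilon)\min_{x'}\|Ax'-b\|_1$, output by the coordinator. In the coordinator model servers communicate only with the coordinator through private two-way channels. $\tilde{O}(f) = f\cdot\mathrm{polylog}(sndL/\epsilon)$.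
   Formalization: The accuracy is restricted to 0 < ε ≤ 1 (and s, n, d, L ≥ 1): for unboundedly large ε the bound sd³L/ε · polylog(sndL/ε) drops below one bit and the claim fails; bounded ε > 1 follows from ε = 1. *)

(* Defs.v *)
From HB Require Import structures.
From mathcomp Require Import all_boot all_order all_algebra.
From mathcomp Require Import all_classical all_reals all_analysis.

Set Implicit Arguments.
Unset Strict Implicit.
Unset Printing Implicit Defensive.

Import Order.TTheory GRing.Theory Num.Theory.
Local Open Scope ring_scope.

(** * The coordinator model

  [protocol X Y]: server [i] holds an input of type [X i], the coordinator has
  no input and outputs an element of [Y].  Every party owns [coins] private
  uniform random bits.  The [s] channels between the coordinator and the
  servers are private: what server [i] sends depends only on its input, its
  coins and the bits exchanged so far on channel [i], whereas the coordinator
  sees all the channels.  Whose turn it is on a channel is a function of the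
  bits exchanged on that channel, hence is known at both ends, so that no
  information travels except through the bits themselves.  The coordinator
  decides on which channel the next bit is transferred; servers do not see
  this choice. *)
Record protocol (s : nat) (X : 'I_s -> Type) (Y : Type) := Protocol {
  coins : nat;
  server_turn : 'I_s -> seq bool -> bool;
  server_bit : forall i : 'I_s, X i -> coins.-tuple bool -> seq bool -> bool;
  coord_next : coins.-tuple bool -> {ffun 'I_s -> seq bool} -> 'I_s + Y;
  coord_bit : coins.-tuple bool -> {ffun 'I_s -> seq bool} -> bool
}.

(** The random strings: that of the coordinator, and those of the servers. *)
Definition coin_space (s : nat) (X : 'I_s -> Type) (Y : Type)
    (P : protocol X Y) : finType :=
  ((coins P).-tuple bool * {ffun 'I_s -> (coins P).-tuple bool})%type.

(** [h i] is the sequence of bits exchanged on channel [i], in both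
  directions. *)
Definition transfer (s : nat) (X : 'I_s -> Type) (Y : Type) (P : protocol X Y)
    (x : forall i, X i) (w : coin_space P) (h : {ffun 'I_s -> seq bool})
    (i : 'I_s) : {ffun 'I_s -> seq bool} :=
  let b := if server_turn P i (h i) then server_bit (x i) (w.2 i) (h i)
           else coord_bit w.1 h in
  [ffun j => if j == i then rcons (h i) b else h j].

(** The output when at most [T] further bits are exchanged from [h] on, and
  [None] if the protocol needs more.  Stopping is legal only when no server is
  in the course of sending, so that every bit sent is counted. *)
Fixpoint run_from (s : nat) (X : 'I_s -> Type) (Y : Type) (P : protocol X Y)
    (x : forall i, X i) (w : coin_space P) (T : nat)
    (h : {ffun 'I_s -> seq bool}) : option Y :=
  match coord_next w.1 h with
  | inr y => if [exists i, server_turn P i (h i)] then None else Some y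
  | inl i => if T is T'.+1 then run_from x w T' (transfer x w h i) else None
  end.

Definition run (s : nat) (X : 'I_s -> Type) (Y : Type) (P : protocol X Y)
    (x : forall i, X i) (w : coin_space P) (T : nat) : option Y :=
  run_from x w T [ffun=> [::]].

(** On input [x], every execution exchanges at most [T] bits in total. *)
Definition uses_bits (s : nat) (X : 'I_s -> Type) (Y : Type)
    (P : protocol X Y) (x : forall i, X i) (T : nat) : bool :=
  [forall w : coin_space P, isSome (run x w T)].

(** Probability, over the coins, that on input [x] the protocol stops within
  [T] bits with an output satisfying [good]. *)
Definition output_prob (R : realType) (s : nat) (X : 'I_s -> Type) (Y : Type)
    (P : protocol X Y) (x : forall i, X i) (T : nat) (good : pred Y) : R :=
  #|[set w : coin_space P | oapp good false (run x w T)]|%:R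
  / #|coin_space P|%:R.

(** * Distributed l1 regression *)

Definition l1norm (R : realType) (m : nat) (v : 'cV[R]_m) : R :=
  \sum_(i < m) `|v i 0|.

(** The infimum is a minimum: the cost is convex and piecewise linear. *)
Definition l1_approx_solution (R : realType) (n d : nat) (A : 'M[R]_(n, d))
    (b : 'cV[R]_n) (eps : R) (x : 'cV[R]_d) : bool :=
  l1norm (A *m x - b)
  <= (1 + eps) * inf (range (fun x' : 'cV[R]_d => l1norm (A *m x' - b))).

Definition server_input (s : nat) (n_ : 'I_s -> nat) (d : nat) (i : 'I_s) :
    Type := ('M[int]_(n_ i, d) * 'cV[int]_(n_ i))%type.

Definition stackA (R : realType) (s : nat) (n_ : 'I_s -> nat) (d : nat)
    (x : forall i, server_input n_ d i) : 'M[R]_(\sum_i n_ i, d) :=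
  \mxcol_i map_mx intr (x i).1.

Definition stackb (R : realType) (s : nat) (n_ : 'I_s -> nat) (d : nat)
    (x : forall i, server_input n_ d i) : 'cV[R]_(\sum_i n_ i) :=
  \mxcol_i map_mx intr (x i).2.

(** Signed integers of [L] bits, the sign not being counted. *)
Definition is_Lbit (L : nat) (z : int) : bool := `|z| < 2 ^+ L.

Definition Lbit_inputs (s : nat) (n_ : 'I_s -> nat) (d L : nat)
    (x : forall i, server_input n_ d i) : Prop :=
  forall i, (forall k j, is_Lbit L ((x i).1 k j)) /\
            (forall k, is_Lbit L ((x i).2 k 0)).

(* Main.v *)
Require Import Defs.
From HB Require Import structures.
From mathcomp Require Import all_boot all_order all_algebra.
From mathcomp Require Import all_classical all_reals all_analysis.
From mathcomp Require Import lra ring zify.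

Set Implicit Arguments.
Unset Strict Implicit.
Unset Printing Implicit Defensive.

Import Order.TTheory GRing.Theory Num.Theory.
Local Open Scope ring_scope.

(** A deterministic protocol does it.  Write [V] for the rows of [A | b], so that
  the cost of [x] is the l1 norm of [V] applied to [(x, -1)].

  Preconditioning: among the rows of an integer matrix of rank [r], the [r] rows
  of largest volume express every row with coefficients at most 1 in absolute
  value.  Applied by each server, and then by the coordinator to the rows it
  received, this produces a matrix [B] made of at most [d + 1] rows of [V], with
  [V = G B] and [|G| <= d + 1].  With [u(x) = B (x, -1)], the cost lies between
  [max_j |u_j(x)|] and a polynomial multiple of it.  If [u] vanishes somewhere,
  that point is optimal; otherwise the optimum is known up to a polynomial
  factor, and a grid of polynomially many values for each [u_j] contains a
  nearly optimal cell.

  Search: one candidate point per cell is kept.  By the centerpoint theorem some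
  [c] is such that every half-space through [c] holds a fraction [1 / (d + 1)] of
  the candidates.  The servers report [gamma = sgn(V (c, -1)) G], rounded; then
  [<gamma, u(x)>] bounds the cost from below, with equality at [c], so the
  candidates where it is at least its value at [c] are no better than [c], up to
  the rounding, and are discarded.  After [O~(d^2)] queries, each of [O~(d)]
  numbers per server, no candidate is left, hence the best query is nearly
  optimal. *)

(** * Round-based protocols *)

Section Lockstep.
Variables (s : nat) (X : 'I_s -> Type) (Y : Type) (N : nat).
Variable turn : nat -> bool.
Variable sbit : forall i : 'I_s, X i -> seq bool -> bool.
Variable cbit : {ffun 'I_s -> seq bool} -> bool.
Variable out : {ffun 'I_s -> seq bool} -> Y.

(** The minimum of [N] and the channel lengths; truncated subtraction turns it into a maximum, which
    has a neutral element in [nat]. *)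
Definition lockstep_level (h : {ffun 'I_s -> seq bool}) : nat :=
  (N - \max_i (N - size (h i)))%N.

(* The channels advance in lockstep: the next bit always goes on a shortest
   channel, and the coordinator ignores the bits beyond that common level. *)
Definition lockstep : protocol X Y := {|
  coins := 0;
  server_turn := fun _ h => turn (size h);
  server_bit := fun i x _ h => sbit x h;
  coord_next := fun _ h =>
    if [pick i | (size (h i) == lockstep_level h) && (lockstep_level h < N)%N]
      is Some i then inl i else inr (out h);
  coord_bit := fun _ h => cbit [ffun i => take (lockstep_level h) (h i)] |}.

Fixpoint lockstep_state (x : forall i, X i) (n : nat) : {ffun 'I_s -> seq bool} :=
  if n is n'.+1 then
    let h := lockstep_state x n' in
    [ffun i => rcons (h i) (if turn n' then sbit (x i) (h i) else cbit h)]
  else [ffun=> [::]].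

Lemma size_lockstep_state x n i : size (lockstep_state x n i) = n.
Proof. by elim: n => [|n IH] /=; rewrite ffunE // size_rcons IH. Qed.

Lemma lockstep_run (x : forall i, X i) (w : coin_space lockstep) :
  (0 < s)%N -> turn N = false ->
  run x w (N * s) = Some (out (lockstep_state x N)).
Proof.
move=> s0 tN; rewrite /run.
(* The configurations met during a run: the channels in [A] have already received bit [n], the
   others have not. *)
pose mix n (A : {set 'I_s}) : {ffun 'I_s -> seq bool} :=
  [ffun j => if j \in A then lockstep_state x n.+1 j else lockstep_state x n j].
have sizeE n A j : size (mix n A j) = ((j \in A) + n)%N.
  by rewrite ffunE; case: (j \in A); rewrite size_lockstep_state.
have mix0 n : mix n finset.set0 = lockstep_state x n.
  by apply/ffunP => j; rewrite ffunE inE.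
have levE n (A : {set 'I_s}) : (n <= N)%N -> (#|A| < s)%N ->
    lockstep_level (mix n A) = n.
  move=> nN As; rewrite /lockstep_level -[RHS](subKn nN); congr subn.
  apply/eqP; rewrite eqn_leq; apply/andP; split.
    by apply/bigop.bigmax_leqP => i _; rewrite sizeE leq_sub2l // leq_addl.
  have /existsP[i iA] : [exists i, i \notin A].
    apply: contraLR As; rewrite negb_exists => /forallP iA.
    rewrite -leqNgt -[s in leqLHS]card_ord -cardsT subset_leq_card //.
    by apply/fintype.subsetP => i _; have := iA i; rewrite negbK.
  by apply: (bigop.bigmax_sup i); rewrite // sizeE (negbTE iA).
(* The budget [T] is exactly the number of bits still to be transferred, [#|A|] of those at level
   [n] being done. *)
suff main T n (A : {set 'I_s}) : (n <= N)%N -> (#|A| < s)%N ->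
    (n = N -> A = finset.set0) ->
    (T + #|A| = (N - n) * s)%N ->
    run_from x w T (mix n A) = Some (out (lockstep_state x N)).
  rewrite -[X in run_from _ _ _ X](mix0 0); apply: main => //; rewrite ?cards0 //.
  by rewrite addn0 subn0.
elim: T n A => [|T IH] n A nN As An.
  move=> /=; rewrite levE // add0n => AE.
  have {}nN : n = N.
    apply/eqP; rewrite eqn_leq nN leqNgt; apply: contraLR As => /negPn lt.
    by rewrite -leqNgt AE leq_pmull // subn_gt0.
  rewrite nN (An nN) mix0 ltnn; case: pickP => [i|_]; first by rewrite andbF.
  case: ifP => // /existsP[i] /=.
  by rewrite size_lockstep_state tN.
have [/[dup] nE /An->|nN'] := eqVneq n N.
  by rewrite nE subnn cards0 mul0n addn0.
have {nN'}nN' : (n < N)%N by rewrite ltn_neqAle nN' nN.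
move=> TE /=; rewrite levE // nN'.
case: pickP => [i|/= no]; last first.
  suff : (s <= #|A|)%N by rewrite leqNgt As.
  rewrite -[s in leqLHS]card_ord -cardsT subset_leq_card //.
  apply/fintype.subsetP => i _; have := no i; rewrite sizeE andbT.
  by case: (i \in A) => //; rewrite add0n eqxx.
rewrite andbT sizeE => iA0.
have iA : i \notin A by move: iA0; case: (i \in A) => //; rewrite add1n eqn_leq ltnn.
have trE : transfer x w (mix n A) i = mix n (i |: A).
  apply/ffunP => j; rewrite !ffunE; case: (eqVneq j i) => [->|ji]; last first.
    by rewrite !inE (negbTE ji).
  rewrite !inE eqxx /= (negbTE iA) size_lockstep_state; congr rcons.
  (* Truncation to the common level hides the extra bit of the channels in [A], so the order of the
     transfers is immaterial. *)
  case: (turn n) => //; congr cbit; apply/ffunP => k.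
  rewrite levE // !ffunE; case: ifP => _; last by rewrite take_oversize ?size_lockstep_state.
  by rewrite -cats1 take_size_cat ?size_lockstep_state.
rewrite trE; have cA : #|i |: A| = #|A|.+1 by rewrite cardsU1 iA.
have [lt|ge] := ltnP #|i |: A| s.
  apply: IH => //; first by move=> nE; rewrite nE ltnn in nN'.
  by rewrite cA addnS -addSn.
have AT : i |: A = [set: 'I_s].
  by apply/eqP; rewrite eqEcard finset.subsetT cardsT card_ord.
have -> : mix n (i |: A) = mix n.+1 finset.set0.
  by rewrite mix0 AT; apply/ffunP => j; rewrite ffunE inE.
apply: IH; rewrite ?cards0 //.
have sA : s = #|A|.+1 by apply/eqP; rewrite eqn_leq -{1}cA ge As.
by move: TE; rewrite -(subnSK nN') mulSn; lia.
Qed.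

End Lockstep.

Lemma block_code (msg : finType) (W : nat) (m0 : msg) : (#|msg| <= 2 ^ W)%N ->
  exists (enc : msg -> seq bool) (dec : seq bool -> msg),
    (forall m, size (enc m) = W) /\ cancel enc dec.
Proof.
move=> le; have le' : (#|msg| <= #|{: W.-tuple bool}|)%N by rewrite card_tuple card_bool.
pose enc (m : msg) : W.-tuple bool := enum_val (widen_ord le' (enum_rank m)).
exists enc, (fun b => odflt m0 [pick m | enc m == b :> seq bool]); split=> [m|m].
  by rewrite size_tuple.
case: pickP => [m' /eqP/val_inj/enum_val_inj/(congr1 val)/= e|/(_ m)]; last by rewrite eqxx.
by apply/enum_rank_inj/val_inj.
Qed.

Section Rounds.
Variables (s : nat) (X : 'I_s -> Type) (Y : Type) (msg : finType).
Variables (W K : nat) (m0 : msg).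
Variable F : forall i : 'I_s, X i -> seq msg -> msg.
Variable G : seq ('I_s -> msg) -> msg.
Variable O : seq ('I_s -> msg) -> Y.

(** A round opens with a broadcast computed from the earlier messages; hence the replies of round
    [t], counted from 0, depend on [t + 1] broadcasts. *)
Fixpoint rounds (x : forall i, X i) (t : nat) : seq ('I_s -> msg) :=
  if t is t'.+1 then
    let tr := rounds x t' in
    rcons tr (fun i => F (x i) (mkseq (fun k => G (take k tr)) t))
  else [::].

Lemma roundsP (x : forall i, X i) :
  exists (b : nat -> msg) (m : nat -> 'I_s -> msg),
  (forall t, b t = G (mkseq m t)) /\ (forall t i, m t i = F (x i) (mkseq b t.+1)).
Proof.
have sz t : size (rounds x t) = t by elim: t => //= t IH; rewrite size_rcons IH.
have tk t k : (k <= t)%N -> take k (rounds x t) = rounds x k.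
  elim: t => [|t IH] /=; first by rewrite leqn0 => /eqP->.
  rewrite leq_eqVlt => /predU1P[->|]; first by rewrite take_oversize // size_rcons sz.
  by rewrite ltnS => kt; rewrite -cats1 takel_cat ?sz // IH.
pose b t := G (rounds x t).
pose m t i := F (x i) (mkseq b t.+1).
have rE t : rounds x t = mkseq m t.
  elim: t => // t IH; rewrite mkseqS -IH /=; congr rcons; apply: funext => i.
  rewrite /m; congr (@F i _ _).
  apply/eq_in_map => k; rewrite mem_iota => /andP[_ kt]; rewrite tk //.
by exists b, m; split=> // t; rewrite /b rE.
Qed.

(** Each channel is cut into blocks of [W] bits: block [2 * k] carries broadcast [k] and block
    [2 * k + 1] the reply. The run stops at the start of an even block, where no server is
    sending. *)
Lemma round_protocol : (0 < s)%N -> (0 < W)%N -> (#|msg| <= 2 ^ W)%N ->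
  exists P : protocol X Y, forall x : (forall i, X i),
  exists (b : nat -> msg) (m : nat -> 'I_s -> msg),
    [/\ forall t, b t = G (mkseq m t),
        forall t i, m t i = F (x i) (mkseq b t.+1) &
        forall w : coin_space P, run x w (2 * K * W * s) = Some (O (mkseq m K))].
Proof.
move=> s0 W0 /(block_code m0)[enc [dec [szE encK]]].
pose block (h : seq bool) j := dec (mkseq (fun r => nth false h (j * W + r)) W).
pose sbit i (y : X i) (h : seq bool) :=
  nth false (enc (F y (mkseq (fun k => block h k.*2) (size h %/ W)./2.+1))) (size h %% W).
pose msgs (h : {ffun 'I_s -> seq bool}) t := mkseq (fun k i => block (h i) k.*2.+1) t.
pose cbit (h : {ffun 'I_s -> seq bool}) :=
  let n := \max_i size (h i) in
  nth false (enc (G (msgs h (n %/ W)./2))) (n %% W).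
pose turn n := odd (n %/ W).
pose P := lockstep (2 * K * W) turn sbit cbit (fun h => O (msgs h K)).
exists P => x; have [b [m [bE mE]]] := roundsP x; exists b, m; split=> // w.
rewrite lockstep_run //; last by rewrite /turn mulnK // oddM.
(* The infinite bit stream that the ideal rounds put on channel [i]; every lockstep state is a
   prefix of it. *)
pose e i j := enc (if odd j then m j./2 i else b j./2).
pose bit i (n : nat) := nth false (e i (n %/ W)%N) (n %% W)%N.
have blockE i n j : (j.+1 * W <= n)%N ->
    block (mkseq (bit i) n) j = if odd j then m j./2 i else b j./2.
  move=> jn; rewrite /block -[RHS]encK; congr dec; apply: (@eq_from_nth _ false).
    by rewrite size_mkseq szE.
  move=> r; rewrite size_mkseq => rW; rewrite nth_mkseq // nth_mkseq.
    by rewrite /bit divnMDl // divn_small // addn0 modnMDl modn_small.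
  by apply: leq_trans jn; rewrite mulSn addnC ltn_add2r.
have msgsE n t : (t.*2 * W <= n)%N -> msgs [ffun i => mkseq (bit i) n] t = mkseq m t.
  move=> tn; apply/eq_in_map => k; rewrite mem_iota add0n => /andP[_ kt].
  apply: funext => i; rewrite ffunE blockE /= ?odd_double ?uphalf_double //.
  by apply: leq_trans tn; rewrite leq_mul2r -doubleS leq_double kt orbT.
have stE n : lockstep_state turn sbit cbit x n = [ffun i => mkseq (bit i) n].
  elim: n => [|n IH] /=; first by apply/ffunP => i; rewrite !ffunE.
  rewrite IH; apply/ffunP => i; rewrite !ffunE mkseqS; congr rcons.
  have le : (n %/ W * W <= n)%N by exact: leq_trunc_div.
  rewrite /turn /bit /e; case: ifP => odd_n.
    rewrite /sbit size_mkseq mE; congr (nth _ (enc (@F i _ _)) _).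
    apply/eq_in_map => k; rewrite mem_iota add0n => /andP[_ kt].
    rewrite blockE ?odd_double ?doubleK //; apply: leq_trans le.
    rewrite leq_mul2r -[X in (_ <= X)%N]odd_double_half odd_n add1n ltnS.
    by rewrite leq_double -ltnS kt orbT.
  rewrite /cbit; set n' := \max__ _.
  have -> : n' = n.
    rewrite /n'; apply/eqP; rewrite eqn_leq; apply/andP; split.
      by apply/bigop.bigmax_leqP => j _; rewrite ffunE size_mkseq.
    by apply: (bigop.bigmax_sup (Ordinal s0)); rewrite // ffunE size_mkseq.
  rewrite msgsE -?bE //; apply: leq_trans le.
  by rewrite -[X in (_ <= X * _)%N]odd_double_half odd_n.
by rewrite stE msgsE // mul2n.
Qed.

End Rounds.

(** * Well-conditioned row bases *)

(** Cramer's rule in the form needed for exchanging one row: the cofactors along row [j] are those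
    of the identity. *)
Lemma det_row_replace (F : comUnitRingType) (r : nat) (j : 'I_r) (v : 'rV[F]_r) :
  \det (\matrix_i (if i == j then v else row i 1%:M)) = v 0 j.
Proof.
set E := \matrix_i _.
have co m : cofactor E j m = (j == m)%:R.
  have -> : cofactor E j m = cofactor 1%:M j m.
    rewrite /cofactor; congr (_ * \det _).
    apply/matrixP => a b; rewrite !mxE.
    by rewrite eq_sym (negbTE (neq_lift _ _)) !mxE.
  have := mul_mx_adj (1%:M : 'M[F]_r); rewrite mul1mx det1 => /matrixP/(_ m j).
  by rewrite !mxE eq_sym.
rewrite (expand_det_row E j) (bigD1 j) //= co eqxx mulr1 mxE eqxx big1 ?addr0 //.
by move=> m mj; rewrite co eq_sym (negbTE mj) mulr0.
Qed.

(** Exchanging the [j]-th selected row for row [k] multiplies the determinant by [C k j]; for a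
    selection of maximal absolute determinant this factor is at most 1. *)
Lemma maxvol_full (F : realFieldType) (N r : nat) (V : 'M[F]_(N, r)) :
  row_full V ->
  exists (g : {ffun 'I_r -> 'I_N}) (C : 'M[F]_(N, r)),
    (forall k j, `|C k j| <= 1) /\ V = C *m rowsub g V.
Proof.
move=> fV.
pose vol (g : {ffun 'I_r -> 'I_N}) := `|\det (rowsub g V)|.
have [g _ gmax] := @arg_maxP _ F _ (fullrankfun fV) xpredT vol isT.
have gpos : 0 < vol g.
  apply: lt_le_trans (gmax (fullrankfun fV) isT).
  rewrite /vol normr_gt0 -unitfE -[_ \is a _]unitmxE -row_full_unit.
  exact: fullrowsub_full.
have Pu : rowsub g V \in unitmx by rewrite unitmxE unitfE -normr_gt0.
exists g, (V *m invmx (rowsub g V)); split; last by rewrite mulmxKV.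
move=> k j; set C := _ *m _.
pose g' := [ffun i => if i == j then k else g i] : {ffun 'I_r -> 'I_N}.
have := gmax g' isT; rewrite /vol.
have -> : rowsub g' V = (\matrix_i (if i == j then row k C else row i 1%:M)) *m rowsub g V.
  apply/row_matrixP => i; rewrite row_mul rowK row_rowsub ffunE.
  case: eqP => _; first by rewrite -row_mul mulmxKV.
  by rewrite -row_mul mul1mx row_rowsub.
rewrite det_mulmx det_row_replace normrM mxE /=.
by rewrite -[leRHS]mul1r ler_pM2r.
Qed.

(** In lower rank the rows are selected in [col_base V], and zero rows pad the selection to the
    fixed size [D]. *)
Lemma maxvol_rows (F : realFieldType) (N D : nat) (V : 'M[F]_(N, D)) :
  exists (g : 'I_D -> option 'I_N) (C : 'M[F]_(N, D)),
    (forall k j, `|C k j| <= 1) /\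
    V = C *m \matrix_j oapp (fun k => row k V) 0 (g j).
Proof.
have [g [C [C1 CE]]] := maxvol_full (col_base_full V).
have VE : V = C *m rowsub g V.
  have -> : rowsub g V = rowsub g (col_base V) *m row_base V.
    by rewrite mul_rowsub_mx mulmx_base.
  by rewrite mulmxA -CE mulmx_base.
exists (fun j => omap g (insub (val j))).
exists (\matrix_(k, j) oapp (C k) 0 (insub (val j))); split=> [k j|].
  by rewrite mxE; case: insub => [l|] /=; rewrite ?normr0.
rewrite {1}VE; apply/matrixP => k l; rewrite !mxE.
pose G i := if insub i is Some j then C k j * V (g j) l else 0.
transitivity (\sum_(j < \rank V) G j).
  by apply: eq_bigr => j _; rewrite /G valK mxE.
rewrite (big_ord_widen D G (rank_leq_col V)) big_mkcond /=.
apply: eq_bigr => j _; rewrite !mxE /G.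
by case: insubP => [i lti _|/negbTE->] /=; rewrite ?lti ?mxE ?mul0r.
Qed.

(** * Centerpoints *)

(** With a coordinate 1 appended, more than [d + 1] vectors in dimension [d + 1] are linearly
    dependent; the extra coordinate gives the zero sum. *)
Lemma affine_dependence (F : fieldType) (J : finType) (d : nat) (A : {set J})
    (p : J -> 'cV[F]_d) : (d.+1 < #|A|)%N ->
  exists lam : J -> F, [/\ exists2 j, j \in A & lam j != 0,
    \sum_(j in A) lam j *: p j = 0 & \sum_(j in A) lam j = 0].
Proof.
move=> dA.
pose P : 'M[F]_(#|A|, d + 1) := \matrix_i row_mx (p (enum_val i))^T 1.
have kn0 : kermx P != 0.
  rewrite kermx_eq0 /row_free neq_ltn; apply/orP; left.
  by apply: leq_ltn_trans (rank_leq_col P) _; rewrite addn1.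
have [v ki vP] : exists2 v : 'rV_#|A|, v != 0 & v *m P = 0.
  have [i ki] : exists i, row i (kermx P) != 0.
    apply/existsP; apply: contraR kn0; rewrite negb_exists => /forallP k0.
    by apply/eqP/row_matrixP => i; have := k0 i; rewrite negbK row0 => /eqP.
  by exists (row i (kermx P)); rewrite // -row_mul mulmx_ker row0.
pose lam j := oapp (fun k => v 0 k) 0 [pick k | enum_val k == j].
have lamE k : lam (enum_val k) = v 0 k.
  rewrite /lam; case: pickP => [l /eqP/enum_val_inj->//|/(_ k)].
  by rewrite eqxx.
have sumE (G : J -> F) :
    \sum_(j in A) lam j * G j = \sum_(k < #|A|) v 0 k * G (enum_val k).
  by rewrite big_enum_val; apply: eq_bigr => k _; rewrite lamE.
exists lam; split=> //.
  have [k vk] : exists k, v 0 k != 0.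
    apply/existsP; apply: contraR ki; rewrite negb_exists => /forallP k0.
    by apply/eqP/rowP => k; rewrite [RHS]mxE; apply/eqP/negPn/k0.
  by exists (enum_val k); rewrite ?enum_valP ?lamE.
  apply/colP => l; rewrite summxE mxE; under eq_bigr do rewrite mxE.
  rewrite sumE; move/rowP/(_ (lshift 1 l)): vP; rewrite !mxE => vP; rewrite -[RHS]vP.
  by apply: eq_bigr => k _; rewrite mxE row_mxEl mxE.
under eq_bigr do rewrite -[lam _]mulr1.
rewrite sumE; move/rowP/(_ (rshift d 0)): vP; rewrite !mxE => vP; rewrite -[RHS]vP.
by apply: eq_bigr => k _; rewrite mxE row_mxEr !mxE.
Qed.

Definition convex_pred (R : realFieldType) (d : nat) (K : 'cV[R]_d -> Prop) :=
  forall (J : finType) (A : {set J}) (w : J -> R) (p : J -> 'cV[R]_d),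
    (forall j, j \in A -> 0 <= w j) -> \sum_(j in A) w j = 1 ->
    (forall j, j \in A -> 0 < w j -> K (p j)) -> K (\sum_(j in A) w j *: p j).

(* Radon's partition of the points [p j], each common to all sets but the
   [j]-th, yields a point common to all. *)
Lemma helly (R : realFieldType) (d : nat) (J : finType)
    (K : J -> 'cV[R]_d -> Prop) (A : {set J}) :
  (forall j, convex_pred (K j)) ->
  (forall B : {set J}, B \subset A -> (#|B| <= d.+1)%N ->
     exists p, forall j, j \in B -> K j p) ->
  exists p, forall j, j \in A -> K j p.
Proof.
move=> cK; elim: {A}#|A| {-2}A (leqnn #|A|) => [|n IH] A An KA.
  by apply: KA => //; apply: leq_trans An _.
have [Ad|dA] := leqP #|A| d.+1; first exact: KA.
have /choice[p pP] : forall i, exists p, forall j, j \in A :\ i -> i \in A -> K j p.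
  move=> i; have [iA|_] := boolP (i \in A); last by exists 0.
  have [||p pP] := IH (A :\ i).
  - by move: An; rewrite (cardsD1 i) iA.
  - move=> B BA Bd; apply: KA => //.
    by apply: fintype.subset_trans BA _; exact: subD1set.
  by exists p => j jA _; exact: pP.
have [lam [[j0 j0A lj0] s0 s1]] := affine_dependence p dA.
pose Pos := [set j in A | 0 < lam j]; pose Neg := [set j in A | lam j <= 0].
have split (V : zmodType) (G : J -> V) :
    \sum_(j in A) G j = \sum_(j in Pos) G j + \sum_(j in Neg) G j.
  rewrite (bigID (fun j => 0 < lam j)) /=; congr (_ + _).
    by apply: eq_bigl => j; rewrite inE.
  by apply: eq_bigl => j; rewrite inE -leNgt.
pose t := \sum_(j in Pos) lam j.
have tN : \sum_(j in Neg) lam j = - t.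
  by apply/eqP; rewrite -addr_eq0 addrC -split s1.
(* The coefficients sum to zero and are not all zero, so some are positive. *)
have t0 : 0 < t.
  have tge : 0 <= t by apply: sumr_ge0 => j; rewrite inE => /andP[_ /ltW].
  rewrite lt_neqAle tge andbT; apply: contra_neqN lj0 => /eqP/esym te.
  have [lp|ln] := ltP 0 (lam j0).
    have /psumr_eq0P : t = 0 by [].
    move=> /(_ _ j0) e; apply/eqP; rewrite e ?inE ?j0A //.
    by move=> j; rewrite inE => /andP[_ /ltW].
  have /psumr_eq0P : \sum_(j in Neg) - lam j = 0.
    by rewrite sumrN tN te !oppr0.
  move=> /(_ _ j0) e; apply/eqP; rewrite -oppr_eq0 e ?inE ?j0A //.
  by move=> j; rewrite inE oppr_ge0 => /andP[].
pose q := \sum_(j in Pos) (lam j / t) *: p j.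
have qN : q = \sum_(j in Neg) (- lam j / t) *: p j.
  have e : t^-1 *: (\sum_(j in A) lam j *: p j) = 0 by rewrite s0 scaler0.
  apply/eqP; rewrite -subr_eq0 -sumrN; apply/eqP; rewrite -[RHS]e split.
  rewrite scalerDr !scaler_sumr; congr (_ + _).
    by apply: eq_bigr => j _; rewrite scalerA mulrC.
  by apply: eq_bigr => j _; rewrite scalerA mulNr scaleNr opprK mulrC.
(* The Radon point is expressed through the side that does not contain [j], all of whose points lie
   in the [j]-th set. *)
exists q => j jA; have [lj|lj] := ltP 0 (lam j).
  rewrite qN; apply: cK => [i|| i].
  - by rewrite inE => /andP[_ li]; rewrite divr_ge0 ?oppr_ge0 // ltW.
  - by rewrite -mulr_suml sumrN tN opprK divff // gt_eqF.
  rewrite inE => /andP[iA li] _; apply: pP => //.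
  by rewrite !inE jA andbT; apply: contraTneq lj => ->; rewrite -leNgt.
apply: cK => [i|| i].
- by rewrite inE => /andP[_ /ltW li]; rewrite divr_ge0 // ltW.
- by rewrite -mulr_suml divff // gt_eqF.
rewrite inE => /andP[iA li] _; apply: pP => //.
by rewrite !inE jA andbT; apply: contraTneq lj => ->; rewrite -ltNge.
Qed.

Definition dotv (R : realFieldType) (d : nat) (g x : 'cV[R]_d) : R :=
  \sum_k g k 0 * x k 0.

Lemma dotv_sum (R : realFieldType) (d : nat) (g : 'cV[R]_d) (J : finType)
    (A : {set J}) (w : J -> R) (p : J -> 'cV[R]_d) :
  dotv g (\sum_(j in A) w j *: p j) = \sum_(j in A) w j * dotv g (p j).
Proof.
rewrite /dotv; under [RHS]eq_bigr do rewrite mulr_sumr.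
rewrite exchange_big /=; apply: eq_bigr => k _.
rewrite summxE mulr_sumr; apply: eq_bigr => j _.
by rewrite mxE mulrCA.
Qed.

(* The closed convex hull, described by the half-spaces containing it; this
   spares any separation theorem. *)
Definition in_hull (R : realFieldType) (d : nat) (J : finType)
    (p : J -> 'cV[R]_d) (T : {set J}) (c : 'cV[R]_d) : Prop :=
  forall (g : 'cV[R]_d) (a : R),
    (forall j, j \in T -> dotv g (p j) <= a) -> dotv g c <= a.

Lemma in_hull_convex (R : realFieldType) (d : nat) (J : finType)
    (p : J -> 'cV[R]_d) (T : {set J}) : convex_pred (in_hull p T).
Proof.
move=> I A w y w0 w1 yP g a gT; rewrite dotv_sum -[leRHS]mul1r -w1 mulr_suml.
apply: ler_sum => i iA; have := w0 i iA; rewrite le_eqVlt => /predU1P[<-|wi].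
  by rewrite !mul0r.
by rewrite ler_pM2l //; apply: (yP i iA wi).
Qed.

Lemma card_bigcup_le (I J : finType) (B : {set I}) (T : I -> {set J}) :
  (#|\bigcup_(i in B) T i| <= \sum_(i in B) #|T i|)%N.
Proof.
elim/big_rec2: _ => [|i n U _ IH]; first by rewrite cards0.
by apply: leq_trans (leq_card_setU _ _) _; rewrite leq_add2l.
Qed.

(** Helly's theorem is applied to the hulls of the subsets holding more than a fraction
    [d / (d + 1)] of [A]: the complements of [d + 1] of them cannot cover [A]. A half-space through
    the common point [c] holding too few points would leave such a subset strictly on its other
    side, though [c] is in its hull. *)
Lemma centerpoint (R : realFieldType) (d : nat) (J : finType)
    (p : J -> 'cV[R]_d) (A : {set J}) : (0 < #|A|)%N ->
  exists c, in_hull p A c /\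
    forall g, (#|A| <= d.+1 * #|[set j in A | (dotv g c <= dotv g (p j))%R]|)%N.
Proof.
move=> Apos.
pose Fam := [set T : {set J} | (T \subset A) && (d * #|A| < d.+1 * #|T|)%N].
have [B BF Bd|c cP] := @helly R d _ (in_hull p) Fam (@in_hull_convex _ _ _ p).
  have [B0|Bn0] := eqVneq B finset.set0.
    by exists 0 => j; rewrite B0 inE.
  have /existsP[j jP] : [exists j in A, [forall T in B, j \in T]].
    apply/contraT; rewrite negb_exists => /forallP nA.
    have : (#|A| <= \sum_(T in B) #|A :\: T|)%N.
      apply: leq_trans (card_bigcup_le _ _); apply/subset_leq_card/fintype.subsetP => j jA.
      have := nA j; rewrite jA negb_forall => /existsP[T]; rewrite negb_imply.
      by move=> /andP[TB jT]; apply/bigcupP; exists T; rewrite // inE jT.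
    rewrite -(leq_pmul2l (ltn0Sn d)) big_distrr /= leqNgt => /negP[].
    have lt T : T \in B -> (d.+1 * #|A :\: T| < #|A|)%N.
      move=> /(fintype.subsetP BF); rewrite inE => /andP[TA].
      rewrite cardsDS // mulnBr ltn_subLR ?leq_mul2l ?subset_leq_card // => dT.
      by rewrite mulSn addnC ltn_add2r.
    have [T0 T0B] := set0Pn _ Bn0.
    apply: (@leq_trans (\sum_(T in B) #|A|)); last by rewrite sum_nat_const leq_mul2r Bd orbT.
    rewrite (bigD1 T0) //= [ltnRHS](bigD1 T0) //= -addSn leq_add ?lt //.
    by apply: leq_sum => T /andP[TB _]; rewrite ltnW ?lt.
  case/andP: jP => jA /forall_inP jP.
  by exists (p j) => T TB g a; apply; exact: jP.
exists c; split.
  by apply: cP; rewrite inE subxx ltn_mul2r Apos /=.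
move=> g; rewrite leqNgt; apply/negP => lt.
pose T := [set j in A | dotv g (p j) < dotv g c].
have AT : #|A| = (#|T| + #|[set j in A | (dotv g c <= dotv g (p j))%R]|)%N.
  rewrite -(cardsID T A); congr addn; apply: eq_card => j; rewrite !inE.
    by rewrite andbA andbb.
  by rewrite andbC; case: (j \in A); rewrite //= -leNgt.
have TF : T \in Fam.
  rewrite inE; apply/andP; split.
    by apply/fintype.subsetP => j; rewrite inE => /andP[].
  by move: lt AT; nia.
have [T0|/set0Pn[j1 j1T]] := eqVneq T finset.set0.
  have : dotv g c <= dotv g c - 1.
    by apply: (cP T TF) => j; rewrite T0 inE.
  by rewrite lerBrDr gerDl ler10.
have [j2 j2T j2max] := @arg_maxP _ R _ j1 (mem T) (fun j => dotv g (p j)) j1T.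
have := cP T TF g (dotv g (p j2)) j2max.
have : j2 \in T by exact: j2T.
by rewrite inE ltNge => /andP[_ /negP].
Qed.

(** * Cutting planes on a finite grid *)

Lemma l1norm_ge0 (R : realType) (m : nat) (v : 'cV[R]_m) : 0 <= l1norm v.
Proof. by apply: sumr_ge0 => i _; exact: normr_ge0. Qed.

Lemma has_inf_range_ge0 (R : realType) (T : Type) (x0 : T) (f : T -> R) :
  (forall x, 0 <= f x) -> has_inf (range f).
Proof.
move=> f0; split; first by exists (f x0), x0.
by exists 0 => _ [x _ <-].
Qed.

Lemma inf_range_le (R : realType) (T : Type) (f : T -> R) (x : T) :
  (forall x, 0 <= f x) -> inf (range f) <= f x.
Proof. by move=> f0; apply: ge_inf; [exists 0 => _ [y _ <-]|exists x]. Qed.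

Lemma inf_range_approx (R : realType) (T : Type) (x0 : T) (f : T -> R) (e : R) :
  (forall x, 0 <= f x) -> 0 < e -> exists x, f x < inf (range f) + e.
Proof.
move=> f0 e0; have [_ [x _ <-] xP] := inf_adherent e0 (has_inf_range_ge0 x0 f0).
by exists x.
Qed.

Lemma precision_gt0 (R : realType) (h : R) : 0 < h -> 0 < 256 * h ^+ 6.
Proof. by move=> h0; apply: mulr_gt0; [rewrite ltr0n|exact: exprn_gt0]. Qed.

Section CuttingPlane.
Variables (R : realType) (d D : nat) (U : 'M[R]_(D, d)) (v : 'cV[R]_D).
Variable q : nat.

Definition resid (x : 'cV[R]_d) : 'cV[R]_D := U *m x - v.

(** A proxy for the optimum that depends only on the common basis. *)
Definition scale : R := inf (range (fun x => l1norm (resid x))).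

Definition cell : finType := {ffun 'I_D -> 'I_(2 ^ (7 * q + 7))}.

(* With [h = 2 ^ q] bounding [s], [n], [D] and [1 / eps], the cost is
   [h ^ 2]-Lipschitz in [resid], and the optimum lies between [scale / h] and
   [2 * h ^ 2 * scale]: this mesh costs [eps / 4], and [2 ^ (7 * q + 7)] cells
   per coordinate reach all points within twice the optimum. *)
Definition mesh : R := (8 * (2 ^+ q) ^+ 5)^-1 * scale.

(** The shift by half the index range allows for residuals of both signs. *)
Definition in_cell (z : cell) (x : 'cV[R]_d) : Prop :=
  forall j, `|resid x j 0 - ((z j)%:R - 2 ^+ (7 * q + 6)) * mesh| <= mesh.

Definition cell_point (z : cell) : 'cV[R]_d := xget 0 [set x | in_cell z x]%classic.

Definition all_cells : {set cell} := [set z | `[< exists x, in_cell z x >]].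

Definition is_center (A : {set cell}) (c : 'cV[R]_d) : Prop :=
  in_hull cell_point A c /\ forall g,
   (#|A| <= d.+1 * #|[set z in A | (dotv g c <= dotv g (cell_point z))%R]|)%N.

(** The choice depends only on the cells and their points, so all parties compute the same query. *)
Definition center (A : {set cell}) : 'cV[R]_d := xget 0 (is_center A).

(** The linear lower bound on the cost given by the rounded replies, in multiples of the rounding
    unit. *)
Definition model (m : 'I_D -> int) (x : 'cV[R]_d) : R :=
  \sum_j (m j)%:~R * resid x j 0.

Definition cut (A : {set cell}) (m : 'I_D -> int) : {set cell} :=
  [set z in A | model m (cell_point z) < model m (center A)].

Definition cells_left (ms : seq ('I_D -> int)) : {set cell} :=
  foldl cut all_cells ms.

Definition query (ms : seq ('I_D -> int)) : 'cV[R]_d := center (cells_left ms).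

(** Once no cell is left, the center is a default point outside the scope of the error bounds; such
    rounds must not compete for the best query. *)
Definition useful (ms : seq ('I_D -> int)) (t : nat) : bool :=
  (t < size ms)%N && (0 < #|cells_left (take t ms)|)%N.

(** An estimate of the cost of query [t], since the lower bound is tight at the query itself. *)
Definition query_value (ms : seq ('I_D -> int)) (t : nat) : R :=
  model (nth (fun=> 0) ms t) (query (take t ms)).

Definition is_best (ms : seq ('I_D -> int)) (t : nat) : Prop :=
  useful ms t /\ forall t', useful ms t' -> query_value ms t <= query_value ms t'.

Definition best (ms : seq ('I_D -> int)) : nat := xget 0%N (is_best ms).

(** The case of an attained zero residual is apart because [scale], hence [mesh], vanishes there. *)
Definition answer (ms : seq ('I_D -> int)) : 'cV[R]_d :=
  if `[< exists x, resid x = 0 >] then xget 0 [set x | resid x = 0]%classic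
  else query (take (best ms) ms).

Lemma cell_pointP z : z \in all_cells -> in_cell z (cell_point z).
Proof.
by rewrite inE => /asboolP[x xz]; rewrite /cell_point; case: xgetP => [y -> //|/(_ x)].
Qed.

Lemma centerP (A : {set cell}) : (0 < #|A|)%N -> is_center A (center A).
Proof.
move=> /(centerpoint cell_point)[c cP].
by rewrite /center; case: xgetP => [y -> //|/(_ c)].
Qed.

Lemma bestP ms t : useful ms t -> is_best ms (best ms).
Proof.
move=> tP; have tn : (t < size ms)%N by case/andP: tP.
have [b bP bmin] := @arg_minP _ R _ (Ordinal tn) (fun b : 'I__ => useful ms b)
  (fun b : 'I__ => query_value ms b) tP.
rewrite /best; case: xgetP => [y -> //|/(_ (val b))[]]; split=> // t' t'P.
have t'n : (t' < size ms)%N by case/andP: t'P.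
exact: (bmin (Ordinal t'n)).
Qed.

Definition model_grad (m : 'I_D -> int) : 'cV[R]_d :=
  \col_k \sum_j (m j)%:~R * U j k.

Lemma modelE m x : model m x = dotv (model_grad m) x - \sum_j (m j)%:~R * v j 0.
Proof.
rewrite /model /dotv; under [X in _ = X - _]eq_bigr do rewrite mxE mulr_suml.
rewrite exchange_big /= -sumrB; apply: eq_bigr => j _.
rewrite !mxE mulrBr mulr_sumr; congr (_ - _).
by apply: eq_bigr => k _; rewrite mulrA.
Qed.

Lemma card_cut (A : {set cell}) m : (d.+1 * #|cut A m| <= d * #|A|)%N.
Proof.
have [A0|A0] := posnP #|A|.
  have /subset_leq_card : cut A m \subset A.
    by apply/fintype.subsetP => z; rewrite inE => /andP[].
  by rewrite A0 leqn0 => /eqP->; rewrite muln0.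
have [_ /(_ (model_grad m))] := centerP A0.
set B := [set z in A | _].
have -> : #|A| = (#|cut A m| + #|B|)%N.
  rewrite -(cardsID (cut A m) A); congr addn; apply: eq_card => z; rewrite !inE.
    by rewrite andbA andbb.
  by rewrite andbC; case: (z \in A); rewrite //= -leNgt !modelE lerD2r.
by nia.
Qed.

(** By Bernoulli's inequality; it says that [d + 1] cuts, each keeping at most a fraction
    [d / (d + 1)], at least halve the number of cells. *)
Lemma expn_succ_ge (k : nat) : (2 * k ^ k.+1 <= k.+1 ^ k.+1)%N.
Proof.
have bern n a : (a ^ n.+1 + n.+1 * a ^ n <= a.+1 ^ n.+1)%N.
  elim: n => [|n IH]; first by rewrite !expn1 expn0; lia.
  apply: (@leq_trans (a.+1 * (a ^ n.+1 + n.+1 * a ^ n))).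
    by rewrite !(expnS a); nia.
  by rewrite [leqRHS]expnS leq_mul2l IH orbT.
by apply: leq_trans (bern k k); rewrite (expnS k k); nia.
Qed.

Lemma card_cells_left ms m0 : (size ms = d.+1 * m0)%N ->
  (2 ^ m0 * #|cells_left ms| <= #|all_cells|)%N.
Proof.
have step ms' : (d.+1 ^ size ms' * #|cells_left ms'| <= d ^ size ms' * #|all_cells|)%N.
  elim/last_ind: ms' => [|ms' m IH] //; rewrite /cells_left foldl_rcons size_rcons.
  rewrite !expnSr -mulnA; apply: leq_trans (leq_mul (leqnn _) (card_cut _ _)) _.
  by rewrite mulnCA -[leqRHS]mulnA [leqRHS]mulnCA leq_mul2l IH orbT.
move=> sz; have := step ms; rewrite sz !expnM => le.
have [d0|dpos] := posnP d.
  move: le; rewrite d0 exp0n // exp1n.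
  case: m0 sz => [|m0] _; first by rewrite !expn0 !mul1n.
  by rewrite exp0n // exp1n mul1n mul0n leqn0 => /eqP->; rewrite muln0.
have dd : (0 < (d ^ d.+1) ^ m0)%N by rewrite !expn_gt0 dpos.
rewrite -(leq_pmul2l dd); apply: leq_trans le; rewrite mulnA -expnMn.
apply: leq_mul => //; case: (m0) => // m.
by rewrite leq_exp2r // mulnC expn_succ_ge.
Qed.

(** The infimum need not be attained for this argument: [v] is outside the column space of [U], so
    some linear form kills the columns of [U] but not [v]. It takes the same nonzero value on every
    residual, which bounds their norms from below. *)
Lemma scale_gt0 : (forall x, resid x <> 0) -> 0 < scale.
Proof.
move=> nz.
have : ~~ (v^T <= U^T)%MS.
  apply/negP => /submxP[x e]; apply: (nz x^T).
  by rewrite /resid -[v]trmxK e trmx_mul trmxK subrr.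
rewrite submxE => /eqP nv.
have [k bk] : exists k, (v^T *m cokermx U^T) 0 k != 0.
  apply/existsP; apply: contraPT nv; rewrite negb_exists => /forallP b0.
  by apply; apply/rowP => k; rewrite [RHS]mxE; apply/eqP/negPn/b0.
move: (mulmx_coker U^T) bk; move: (cokermx U^T) => w Uw.
set beta := _ 0 k => bk.
have wE x : \sum_j w j k * resid x j 0 = - beta.
  transitivity (((resid x)^T *m w) 0 k).
    rewrite [RHS]mxE; apply: eq_bigr => j _; rewrite mulrC; congr (_ * _).
    by rewrite [RHS]mxE.
  by rewrite /resid linearB /= trmx_mul mulmxBl -mulmxA Uw mulmx0 sub0r [LHS]mxE.
pose W := \sum_j `|w j k|.
have le x : `|beta| <= W * l1norm (resid x).
  rewrite -normrN -(wE x); apply: le_trans (ler_norm_sum _ _ _) _.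
  rewrite /W mulr_suml; apply: ler_sum => j _; rewrite normrM ler_wpM2l //.
  by rewrite /l1norm (bigD1 j) //= lerDl sumr_ge0.
have W0 : 0 < W.
  rewrite lt_neqAle sumr_ge0 // andbT; apply: contraTneq (le 0) => <-.
  by rewrite mul0r -ltNge normr_gt0.
apply: (@lt_le_trans _ _ (`|beta| / W)); first by rewrite divr_gt0 ?normr_gt0.
apply: lb_le_inf; first by exists (l1norm (resid 0)), 0.
by move=> _ [x _ <-]; rewrite ler_pdivrMr // mulrC.
Qed.

(** * Error analysis of the cutting plane search *)

Section Analysis.
Variables (f : 'cV[R]_d -> R) (ms : nat -> 'I_D -> int) (gam : nat -> 'I_D -> R).
Variables (n0 : nat) (eps : R).
Let h : R := 2 ^+ q.
Let delta : R := (256 * h ^+ 6)^-1.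
Let c (t : nat) := query (mkseq ms t).

Hypothesis f_ge0 : forall x, 0 <= f x.
Hypothesis resid_le : forall x j, `|resid x j 0| <= f x.
Hypothesis f_le : forall x, f x <= h ^+ 2 * l1norm (resid x).
Hypothesis f_lip : forall x y, f x <= f y + h ^+ 2 * l1norm (resid x - resid y).
Hypothesis gam_le : forall t, (t < n0)%N ->
  forall x, \sum_j gam t j * resid x j 0 <= f x.
Hypothesis gam_query : forall t, (t < n0)%N ->
  \sum_j gam t j * resid (c t) j 0 = f (c t).
Hypothesis gam_round : forall t j, (t < n0)%N ->
  `|gam t j - delta * (ms t j)%:~R| <= h * delta.
Hypothesis eps_bounds : 0 < eps <= 1.
Hypothesis eps_h : 1 <= eps * h.
Hypothesis D_h : D%:R <= h.
Hypothesis n0E : (n0 = d.+1 * ((7 * q + 7) * D).+1)%N.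
Hypothesis no_exact : forall x, resid x <> 0.
Let opt := inf (range f).
Let nu := scale.

Let h1 : 1 <= h.
Proof. by rewrite /h exprn_ege1 // ler1n. Qed.

Let h0 : 0 < h. Proof. exact: lt_le_trans h1. Qed.

Let delta0 : 0 < delta.
Proof. by rewrite /delta invr_gt0; exact: precision_gt0. Qed.

Let nu0 : 0 < nu. Proof. exact: scale_gt0. Qed.

Let mesh0 : 0 < mesh.
Proof. by rewrite mulr_gt0 // invr_gt0 mulr_gt0 ?exprn_gt0. Qed.

Lemma scale_le_opt : nu <= h * opt.
Proof.
rewrite mulrC -ler_pdivrMr //; apply: lb_le_inf; first by exists (f 0), 0.
move=> _ [x _ <-]; rewrite ler_pdivrMr // mulrC.
apply: le_trans (inf_range_le x (fun x => l1norm_ge0 (resid x))) _.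
apply: (@le_trans _ _ (D%:R * f x)); last by rewrite ler_wpM2r.
rewrite -[D in leRHS]card_ord -sum1_card natr_sum mulr_suml.
by apply: ler_sum => j _; rewrite mul1r.
Qed.

Lemma opt_le_scale : opt <= 2 * h ^+ 2 * nu.
Proof.
have [x xP] := inf_range_approx 0 (fun x => l1norm_ge0 (resid x)) nu0.
apply: le_trans (inf_range_le x f_ge0) _; apply: le_trans (f_le x) _.
have le : l1norm (resid x) <= 2 * nu by rewrite mulr_natl mulr2n; exact: ltW xP.
apply: le_trans (ler_wpM2l (exprn_ge0 2 (ltW h0)) le) _.
by rewrite mulrA [2 * _]mulrC.
Qed.

Let opt0 : 0 < opt.
Proof. by have := lt_le_trans nu0 scale_le_opt; rewrite pmulr_rgt0. Qed.

(** A point within [eps / 4 * opt] of the optimum lies in some cell, whose representative differs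
    from it by at most [2 * mesh] per coordinate; by the Lipschitz bound this costs at most
    [eps / 4 * opt] more. *)
Lemma good_cell :
  exists2 z, z \in all_cells & f (cell_point z) <= (1 + eps / 2) * opt.
Proof.
have e0 : 0 < eps / 4 * opt by case/andP: eps_bounds => e0 _; rewrite !mulr_gt0 ?invr_gt0.
have [x xP] := inf_range_approx (0 : 'cV[R]_d) f_ge0 e0; rewrite -/opt in xP.
have mE : mesh * (8 * h ^+ 5) = nu.
  by rewrite /mesh mulrAC mulVf ?mul1r // gt_eqF // mulr_gt0 ?exprn_gt0.
pose N : nat := (2 ^ (7 * q + 6))%N.
have NE : N%:R = 64 * h ^+ 7 :> R.
  by rewrite /N natrX exprD mulrC /h -exprM mulnC; congr (_ * _); rewrite -natrX.
(* The left side is at most [2 * opt], that is [32 * h ^ 7] meshes, while [N] is [64 * h ^ 7]. *)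
have xb j : `|resid x j 0| <= (N%:R - 1) * mesh.
  apply: le_trans (resid_le x j) _.
  have fx : f x <= 2 * opt.
    by apply: ltW; apply: lt_le_trans xP _; case/andP: eps_bounds; nra.
  have := opt_le_scale; rewrite -mE NE.
  have : 1 <= h ^+ 7 by rewrite exprn_ege1.
  have -> : 2 * h ^+ 2 * (mesh * (8 * h ^+ 5)) = 16 * h ^+ 7 * mesh by ring.
  by move: mesh0; nra.
pose k j := absz (Num.floor (resid x j 0 / mesh + N%:R)).
have y0 j : 0 <= resid x j 0 / mesh + N%:R.
  rewrite -(pmulr_lge0 _ mesh0) mulrDl divfK ?gt_eqF //.
  by move: (xb j); rewrite ler_norml => /andP[+ _]; move: mesh0; lra.
have kE j : (k j)%:R = (Num.floor (resid x j 0 / mesh + N%:R))%:~R :> R.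
  by rewrite /k natr_absz ger0_norm ?floor_ge0.
have kle j : (k j)%:R <= resid x j 0 / mesh + N%:R by rewrite kE floor_le_tmp.
have klt j : resid x j 0 / mesh + N%:R < (k j)%:R + 1.
  by rewrite kE -intrD1 floorD1_gt.
have kN j : (k j < 2 ^ (7 * q + 7))%N.
  rewrite -(ltr_nat R); apply: le_lt_trans (kle j) _.
  have -> : (2 ^ (7 * q + 7))%:R = N%:R + N%:R :> R.
    by rewrite -natrD addnn -mul2n -expnS addnS.
  rewrite ltrD2r ltr_pdivrMr //; apply: le_lt_trans (ler_norm _) _.
  by apply: le_lt_trans (xb j) _; rewrite ltr_pM2r // gtrBl.
pose z : cell := [ffun j => Ordinal (kN j)].
have xz : in_cell z x.
  move=> j; rewrite ffunE /= -natrX -/N.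
  rewrite -[resid x j 0](divfK (lt0r_neq0 mesh0)) -mulrBl normrM (gtr0_norm mesh0).
  rewrite -[leRHS]mul1r ler_pM2r // ler_norml.
  by move: (kle j) (klt j); lra.
have zA : z \in all_cells by rewrite inE; apply/asboolP; exists x.
exists z => //; have yz := cell_pointP zA.
apply: le_trans (f_lip _ x) _.
have : l1norm (resid (cell_point z) - resid x) <= h * (2 * mesh).
  apply: (@le_trans _ _ (D%:R * (2 * mesh))); last by rewrite ler_wpM2r // mulr_ge0 // ltW.
  rewrite -[D in leRHS]card_ord -sum1_card natr_sum mulr_suml.
  apply: ler_sum => j _; rewrite mul1r [X in `|X|]mxE [X in _ + X]mxE.
  move: (xz j) (yz j); set a := resid x j 0; set b := resid _ j 0; set e := (_ * _).
  by rewrite !ler_norml => /andP[? ?] /andP[? ?]; apply/andP; split; lra.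
move=> /(ler_wpM2l (exprn_ge0 2 (ltW h0))) le.
have : h ^+ 2 * (h * (2 * mesh)) <= eps / 4 * opt.
  have := scale_le_opt; rewrite -mE => le'.
  have : mesh * 8 * h ^+ 4 <= opt.
    rewrite -(ler_pM2l h0); apply: le_trans le'.
    by rewrite le_eqVlt; apply/orP; left; apply/eqP; ring.
  move=> le2; apply: (@le_trans _ _ (eps / 4 * (mesh * 8 * h ^+ 4))); last first.
    by rewrite ler_wpM2l // divr_ge0 //; case/andP: eps_bounds => /ltW.
  have -> : eps / 4 * (mesh * 8 * h ^+ 4) = (eps * h) * (2 * mesh * h ^+ 3) by field.
  have -> : h ^+ 2 * (h * (2 * mesh)) = 1 * (2 * mesh * h ^+ 3) by ring.
  by rewrite ler_wpM2r // mulr_ge0 ?exprn_ge0 ?mulr_ge0 // ltW.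
by move: xP le; lra.
Qed.

(** At cell points the index range limits each coordinate to [64 * h ^ 7 + 1] meshes, fewer than the
    [72 * h ^ 7] of the bound; two half-spaces per coordinate carry this over to the hull. *)
Lemma resid_hull (A : {set cell}) y (j : 'I_D) :
  A \subset all_cells -> in_hull cell_point A y ->
  `|resid y j 0| <= 9 * h ^+ 2 * nu.
Proof.
move=> /fintype.subsetP sA yA.
have b z : z \in A -> `|resid (cell_point z) j 0| <= 9 * h ^+ 2 * nu.
  move=> /sA/cell_pointP/(_ j); set m := mesh => zP.
  have mE : m * (8 * h ^+ 5) = nu.
    by rewrite /m /mesh mulrAC mulVf ?mul1r // gt_eqF // mulr_gt0 ?exprn_gt0.
  have NE : 2 ^+ (7 * q + 6) = 64 * h ^+ 7 :> R.
    by rewrite exprD mulrC /h -exprM mulnC; congr (_ * _); rewrite -natrX.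
  have z0 : 0 <= (z j)%:R :> R by [].
  have z1 : (z j)%:R <= 128 * h ^+ 7 :> R.
    have -> : 128 * h ^+ 7 = (2 ^ (7 * q + 7))%:R :> R.
      by rewrite natrX addnS [RHS]exprS NE mulrA; congr (_ * _); rewrite -natrM.
    by rewrite ler_nat ltnW.
  have hh : 1 <= h ^+ 7 by rewrite exprn_ege1.
  have mm : 0 < m by [].
  rewrite -mE (_ : 9 * h ^+ 2 * (m * (8 * h ^+ 5)) = (72 * h ^+ 7) * m); last by ring.
  move: zP; rewrite NE !ler_norml => /andP[? ?]; apply/andP; split; nra.
have hullb (sg : R) : `|sg| = 1 -> sg * resid y j 0 <= 9 * h ^+ 2 * nu.
  move=> sg1; pose g : 'cV[R]_d := \col_k (sg * U j k).
  have gE x : sg * resid x j 0 = dotv g x - sg * v j 0.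
    rewrite !mxE mulrBr mulr_sumr; congr (_ - _).
    by apply: eq_bigr => k _; rewrite mxE mulrA.
  rewrite gE lerBlDr; apply: yA => z zA; rewrite -lerBlDr -gE.
  by apply: le_trans (ler_norm _) _; rewrite normrM sg1 mul1r b.
rewrite ler_norml lerNl; have := hullb 1; have := hullb (-1).
by rewrite normrN normr1 mul1r mulN1r => -> // ->.
Qed.

Lemma cells_left_sub s : cells_left s \subset all_cells.
Proof.
rewrite /cells_left; elim/last_ind: s => [|s m IH] //; rewrite foldl_rcons.
by apply: fintype.subset_trans IH; apply/fintype.subsetP => z; rewrite inE => /andP[].
Qed.

Let err : R := eps / 16 * opt.

(** At most [h] coordinates each contribute [h * delta] times [9 * h ^ 2 * nu]. With [nu <= h * opt]
    the total is at most [9 / (256 * h) * opt], which the choice of [delta] makes smaller than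
    [err]. *)
Lemma model_error t y :
  (t < n0)%N -> (forall j, `|resid y j 0| <= 9 * h ^+ 2 * nu) ->
  `|\sum_j gam t j * resid y j 0 - delta * model (ms t) y| <= err.
Proof.
move=> tn yb.
rewrite /model mulr_sumr -sumrB; apply: le_trans (ler_norm_sum _ _ _) _.
apply: (@le_trans _ _ (\sum_(j < D) (h * delta) * (9 * h ^+ 2 * nu))).
  apply: ler_sum => j _; rewrite [delta * _]mulrA -mulrBl normrM; apply: ler_pM => //.
  exact: gam_round.
rewrite sumr_const card_ord -[leLHS]mulr_natl.
apply: (@le_trans _ _ (h * ((h * delta) * (9 * h ^+ 2 * nu)))).
  by rewrite ler_wpM2r // !mulr_ge0 ?exprn_ge0 // ltW.
apply: (@le_trans _ _ (h * ((h * delta) * (9 * h ^+ 2 * (h * opt))))).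
  by rewrite !ler_pM2l ?mulr_gt0 ?exprn_gt0 // scale_le_opt.
have dE : delta * (256 * h ^+ 6) = 1.
  by apply: mulVf; exact: lt0r_neq0 (precision_gt0 h0).
have -> : h * ((h * delta) * (9 * h ^+ 2 * (h * opt))) = (9 * delta * h ^+ 5) * opt by ring.
rewrite ler_pM2r //.
have : 9 * delta * h ^+ 5 * (16 * h) <= 1.
  have -> : 9 * delta * h ^+ 5 * (16 * h) = 144 / 256 * (delta * (256 * h ^+ 6)) by field.
  by rewrite dE; lra.
by move: eps_h h0; nra.
Qed.

(** All cells are eventually discarded, in particular the good cell [z]. In the round [t] where this
    happens the model is at least as large at [z] as at the query, so query [t] costs at most what
    [z] does, up to rounding; the best query loses no more. *)
Lemma answer_no_exact :
  f (query (take (best (mkseq ms n0)) (mkseq ms n0))) <= (1 + eps) * opt.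
Proof.
have [z zA zf] := good_cell.
(* There is one halving more than the binary logarithm of the number of cells. *)
have empty : cells_left (mkseq ms n0) = finset.set0.
  apply/eqP; rewrite -cards_eq0 -leqn0 -ltnS.
  have : (size (mkseq ms n0) = d.+1 * ((7 * q + 7) * D).+1)%N by rewrite size_mkseq.
  move=> /card_cells_left le.
  have : (#|all_cells| <= 2 ^ ((7 * q + 7) * D))%N.
    apply: leq_trans (max_card _) _.
    by rewrite card_ffun !card_ord -expnM.
  rewrite -(ltn_pmul2l (expn_gt0 2 ((7 * q + 7) * D).+1)) muln1 => le2.
  by apply: leq_ltn_trans le _; apply: leq_ltn_trans le2 _; rewrite ltn_exp2l.
have takeE t : (t <= n0)%N -> take t (mkseq ms n0) = mkseq ms t.
  by move=> tn; rewrite /mkseq -map_take take_iota (minn_idPl tn).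
have [t tn [zt zt1]] : exists2 t, (t < n0)%N &
    z \in cells_left (mkseq ms t) /\ z \notin cells_left (mkseq ms t.+1).
  have : z \notin cells_left (mkseq ms n0) by rewrite empty inE.
  elim: (n0) => [|k IH] zk; first by rewrite zA in zk.
  have [zk'|/IH[t tk tP]] := boolP (z \in cells_left (mkseq ms k)).
    by exists k.
  by exists t => //; exact: ltnW.
have usefulE t' : (t' < n0)%N ->
    useful (mkseq ms n0) t' = (0 < #|cells_left (mkseq ms t')|)%N.
  by move=> t'n; rewrite /useful size_mkseq t'n takeE // ltnW.
have valE t' : (t' < n0)%N -> query_value (mkseq ms n0) t' = model (ms t') (c t').
  by move=> t'n; rewrite /query_value nth_mkseq // takeE // ltnW.
have cb t' : (0 < #|cells_left (mkseq ms t')|)%N ->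
    forall j, `|resid (c t') j 0| <= 9 * h ^+ 2 * nu.
  by move=> /centerP[hull _] j; apply: resid_hull hull; exact: cells_left_sub.
have tu : useful (mkseq ms n0) t.
  by rewrite usefulE // card_gt0; apply/set0Pn; exists z.
have [bu bmin] := bestP tu; set b := best _ in bu bmin *.
have bn : (b < n0)%N by case/andP: bu; rewrite size_mkseq.
rewrite takeE ?(ltnW bn) // -/(c b).
have fb := cb b; rewrite -usefulE // in fb; move/(_ bu) in fb.
have ft := cb t; rewrite -usefulE // in ft; move/(_ tu) in ft.
have eb := model_error bn fb; have et := model_error tn ft.
have ez : `|\sum_j gam t j * resid (cell_point z) j 0
    - delta * model (ms t) (cell_point z)| <= err.
  apply: model_error => // j; apply: (@resid_hull all_cells) => //.
  by move=> g a; apply.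
have zge : model (ms t) (c t) <= model (ms t) (cell_point z).
  by move: zt1; rewrite /cells_left mkseqS foldl_rcons !inE zt /= -leNgt.
have := bmin t tu; rewrite !valE // => bt.
rewrite !gam_query // in eb et.
have gz := gam_le tn (cell_point z).
rewrite -(ler_pM2l delta0) in zge; rewrite -(ler_pM2l delta0) in bt.
move: eb et ez; rewrite !ler_norml => /andP[? ?] /andP[? ?] /andP[? ?].
have errE : 4 * err = eps / 4 * opt by rewrite /err; field.
have : eps * opt >= 0 by case/andP: eps_bounds => e0 _; rewrite mulr_ge0 ?ltW.
by lra.
Qed.

End Analysis.

End CuttingPlane.

Lemma answer_approx (R : realType) (d D : nat) (U : 'M[R]_(D, d)) (v : 'cV[R]_D)
    (q n0 : nat) (f : 'cV[R]_d -> R) (ms : nat -> 'I_D -> int)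
    (gam : nat -> 'I_D -> R) (eps : R) :
  let h : R := 2 ^+ q in
  let delta : R := (256 * h ^+ 6)^-1 in
  let c t := query U v q (mkseq ms t) in
  (forall x, 0 <= f x) ->
  (forall x j, `|resid U v x j 0| <= f x) ->
  (forall x, f x <= h ^+ 2 * l1norm (resid U v x)) ->
  (forall x y, f x <= f y + h ^+ 2 * l1norm (resid U v x - resid U v y)) ->
  (forall t, (t < n0)%N -> forall x, \sum_j gam t j * resid U v x j 0 <= f x) ->
  (forall t, (t < n0)%N -> \sum_j gam t j * resid U v (c t) j 0 = f (c t)) ->
  (forall t j, (t < n0)%N -> `|gam t j - delta * (ms t j)%:~R| <= h * delta) ->
  0 < eps <= 1 -> 1 <= eps * h -> D%:R <= h ->
  (n0 = d.+1 * ((7 * q + 7) * D).+1)%N ->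
  f (answer U v q (mkseq ms n0)) <= (1 + eps) * inf (range f).
Proof.
move=> h delta c f0 H1 H2 H3 H4 H5 H6 eps_bounds H8 H9 H10.
rewrite /answer; case: asboolP => [[x0 x0P]|nex].
  case: xgetP => [x -> /= xP|/(_ x0)//].
  apply: (@le_trans _ _ 0).
    apply: le_trans (H2 _) _; rewrite xP /l1norm big1 ?mulr0 // => j _.
    by rewrite mxE normr0.
  case/andP: eps_bounds => e0 _; apply: mulr_ge0; first by rewrite addr_ge0 // ltW.
  by apply: lb_le_inf; [exists (f 0), 0|move=> _ [x' _ <-]].
apply: answer_no_exact H3 H4 H5 H6 _ _ _ _ _ => //.
by move=> x xP; apply: nex; exists x.
Qed.

(** * Subgradients of the l1 cost in the preconditioned coordinates *)

Definition sign_comb (R : realType) (n D : nat) (G : 'M[R]_(n, D)) (r : 'cV[R]_n)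
    (j : 'I_D) : R := \sum_k Num.sg (r k 0) * G k j.

(** Signs are at most 1 in absolute value. The bound is tight when [r] is [G *m w], which makes
    [sign_comb] a subgradient there; by homogeneity it has no constant term. *)
Lemma sign_comb_le (R : realType) (n D : nat) (G : 'M[R]_(n, D)) (r : 'cV[R]_n)
    (w : 'cV[R]_D) :
  \sum_j sign_comb G r j * w j 0 <= l1norm (G *m w).
Proof.
rewrite /sign_comb; under eq_bigr do rewrite mulr_suml.
rewrite exchange_big /=; apply: ler_sum => k _; rewrite mxE.
under eq_bigr do rewrite -mulrA.
rewrite -mulr_sumr; apply: le_trans (ler_norm _) _; rewrite normrM.
rewrite -[leRHS]mul1r ler_wpM2r // normr_sg.
by case: (_ != _).
Qed.

Lemma sign_comb_eq (R : realType) (n D : nat) (G : 'M[R]_(n, D)) (w : 'cV[R]_D) :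
  \sum_j sign_comb G (G *m w) j * w j 0 = l1norm (G *m w).
Proof.
rewrite /sign_comb; under eq_bigr do rewrite mulr_suml.
rewrite exchange_big /=; apply: eq_bigr => k _; rewrite normrEsg.
move: (Num.sg _) => sg; rewrite mxE mulr_sumr.
by apply: eq_bigr => j _; rewrite mulrA.
Qed.

Lemma sign_comb_bound (R : realType) (n D : nat) (G : 'M[R]_(n, D)) (B : R)
    (r : 'cV[R]_n) j : 0 <= B -> (forall k j, `|G k j| <= B) ->
  `|sign_comb G r j| <= n%:R * B.
Proof.
move=> B0 GB; apply: le_trans (ler_norm_sum _ _ _) _.
rewrite -[n in leRHS]card_ord -sum1_card natr_sum mulr_suml.
apply: ler_sum => k _; rewrite normrM; apply: ler_pM => //.
by rewrite normr_sg; case: (_ != _).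
Qed.

Lemma l1norm_mulmx (R : realType) (n D : nat) (G : 'M[R]_(n, D)) (B : R)
    (w : 'cV[R]_D) : (forall k j, `|G k j| <= B) ->
  l1norm (G *m w) <= n%:R * B * l1norm w.
Proof.
move=> GB; rewrite -[n in leRHS]card_ord -sum1_card natr_sum !mulr_suml.
apply: ler_sum => k _; rewrite mul1r mxE; apply: le_trans (ler_norm_sum _ _ _) _.
rewrite mulr_sumr; apply: ler_sum => j _.
by rewrite normrM ler_wpM2r.
Qed.

Lemma l1normD (R : realType) (n : nat) (a b : 'cV[R]_n) :
  l1norm (a + b) <= l1norm a + l1norm b.
Proof.
by rewrite /l1norm -big_split /=; apply: ler_sum => i _; rewrite mxE ler_normD.
Qed.

Lemma answer_regression (R : realType) (s d D q n0 : nat) (n_ : 'I_s -> nat)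
    (A : forall i, 'M[R]_(n_ i, d)) (b : forall i, 'cV[R]_(n_ i))
    (U : 'M[R]_(D, d)) (v : 'cV[R]_D) (G : forall i, 'M[R]_(n_ i, D))
    (ms : nat -> 'I_D -> int) (eps : R) :
  let h : R := 2 ^+ q in
  let delta : R := (256 * h ^+ 6)^-1 in
  let f x := \sum_i l1norm (A i *m x - b i) in
  (forall i, A i = G i *m U) -> (forall i, b i = G i *m v) ->
  (forall i k j, `|G i k j| <= D%:R) ->
  (forall x j, `|resid U v x j 0| <= f x) ->
  (forall t j, (t < n0)%N -> ms t j =
    \sum_i Num.floor (sign_comb (G i) (A i *m query U v q (mkseq ms t) - b i) j / delta)) ->
  0 < eps <= 1 -> 1 <= eps * h -> D%:R <= h -> s%:R <= h -> (\sum_i n_ i)%:R <= h ->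
  (n0 = d.+1 * ((7 * q + 7) * D).+1)%N ->
  f (answer U v q (mkseq ms n0)) <= (1 + eps) * inf (range f).
Proof.
move=> h delta f AE bE GD fres msE e01 eh Dh sh nh n0E.
have h0 : 0 < h by rewrite exprn_gt0.
have rE i x : A i *m x - b i = G i *m resid U v x.
  by rewrite AE bE /resid mulmxBr mulmxA.
have sumn (w : 'cV[R]_D) : \sum_i l1norm (G i *m w) <= h ^+ 2 * l1norm w.
  apply: (@le_trans _ _ (\sum_i (n_ i)%:R * D%:R * l1norm w)).
    by apply: ler_sum => i _; apply: l1norm_mulmx.
  rewrite -mulr_suml ler_wpM2r ?l1norm_ge0 // -mulr_suml -natr_sum expr2.
  exact: ler_pM.
pose gam t j := \sum_i sign_comb (G i) (A i *m query U v q (mkseq ms t) - b i) j.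
have gamE t (w : 'cV[R]_D) : \sum_j gam t j * w j 0 =
    \sum_i \sum_j sign_comb (G i) (A i *m query U v q (mkseq ms t) - b i) j * w j 0.
  by rewrite exchange_big /=; apply: eq_bigr => j _; rewrite mulr_suml.
apply: (@answer_approx _ _ _ U v q n0 f ms gam) => //.
- by move=> x; apply: sumr_ge0 => i _; exact: l1norm_ge0.
- by move=> x; apply: le_trans (sumn _); apply: ler_sum => i _; rewrite rE.
- move=> x y; apply: le_trans (lerD (lexx _) (sumn _)).
  rewrite /f -big_split /=; apply: ler_sum => i _.
  rewrite !rE; apply: le_trans (l1normD _ _).
  by rewrite -mulmxDr addrC subrK.
- move=> t _ x; rewrite gamE; apply: ler_sum => i _; rewrite [in leRHS]rE.
  exact: sign_comb_le.
- move=> t _; rewrite gamE; apply: eq_bigr => i _; rewrite !rE.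
  exact: sign_comb_eq.
- move=> t j tn; rewrite msE // rmorph_sum /= mulr_sumr -sumrB.
  have d0 : 0 < delta by rewrite invr_gt0; exact: precision_gt0.
  apply: le_trans (ler_norm_sum _ _ _) _.
  (* Each server's floor loses at most one unit [delta], and there are at most [h] servers. *)
  apply: (@le_trans _ _ (\sum_(i < s) delta)).
    apply: ler_sum => i _; set g := sign_comb _ _ _.
    have /andP[f1 f2] := real_floor_itv (num_real (g / delta)).
    move: f1 f2; rewrite ler_pdivlMr // ltr_pdivrMr // intrD => f1 f2.
    rewrite ler_norml; apply/andP; split.
      by rewrite [delta * _]mulrC; move: f1 d0; lra.
    by rewrite [delta * _]mulrC; move: f2; rewrite mulrDl mul1r; lra.
  by rewrite sumr_const card_ord -[leLHS]mulr_natl ler_pM2r.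
Qed.

(** * The regression protocol *)

Lemma l1norm_stack (R : realType) (s : nat) (n_ : 'I_s -> nat) (d : nat)
    (x : forall i, server_input n_ d i) (y : 'cV[R]_d) :
  l1norm (stackA R x *m y - stackb R x) =
  \sum_i l1norm (map_mx intr (x i).1 *m y - map_mx intr (x i).2).
Proof.
rewrite /stackA /stackb mxcol_mul -mxcolB /l1norm.
rewrite sig_big_dep /= (reindex _ tagnat.sig_bij_on) /=.
by apply: eq_bigr => k _; rewrite [X in `|X|]mxE.
Qed.

(** * Row bases of the servers and of the coordinator *)

Definition spans (R : realType) (N D : nat) (V : 'M[int]_(N, D))
    (B : 'M[int]_D) : Prop :=
  (forall j, row j B = 0 \/ exists k, row j B = row k V) /\
  exists C : 'M[R]_(N, D), (forall k j, `|C k j| <= 1) /\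
    map_mx intr V = C *m map_mx intr B.

Definition span_rows (R : realType) (N D : nat) (V : 'M[int]_(N, D)) : 'M[int]_D :=
  xget 0 (@spans R N D V).

Lemma span_rowsP (R : realType) (N D : nat) (V : 'M[int]_(N, D)) :
  spans R V (span_rows R V).
Proof.
have [g [C [C1 CE]]] := maxvol_rows (map_mx intr V : 'M[R]_(N, D)).
pose B := \matrix_j oapp (fun k => row k V) 0 (g j).
suff BP : spans R V B by rewrite /span_rows; case: xgetP => [y -> //|/(_ B)].
split=> [j|].
  by rewrite rowK; case: (g j) => [k|] /=; [right; exists k|left].
exists C; split=> //; rewrite {1}CE; congr (_ *m _).
apply/row_matrixP => j; rewrite rowK -map_row rowK.
by case: (g j) => [k|] /=; rewrite ?map_row ?raddf0 // map_mx0.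
Qed.

Definition all_rows (s D : nat) (B : 'I_s -> 'M[int]_D) :
    'M[int]_(#|{: 'I_s * 'I_D}|, D) :=
  \matrix_k row (enum_val k).2 (B (enum_val k).1).

Definition bounded_coeffs (R : realType) (N D : nat) (V : 'M[int]_(N, D))
    (B : 'M[int]_D) (G : 'M[R]_(N, D)) : Prop :=
  (forall k j, `|G k j| <= D%:R) /\ map_mx intr V = G *m map_mx intr B.

Definition coeffs (R : realType) (N D : nat) (V : 'M[int]_(N, D))
    (B : 'M[int]_D) : 'M[R]_(N, D) := xget 0 (bounded_coeffs V B).

Section TwoLevelBasis.
Variables (R : realType) (s D : nat) (n_ : 'I_s -> nat).
Variable V : forall i, 'M[int]_(n_ i, D).
Let B i := span_rows R (V i).
Let Bf := span_rows R (all_rows B).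

(** The coefficients are products of two matrices with entries at most 1 and inner dimension [D]. *)
Lemma coeffsP i : bounded_coeffs (V i) Bf (coeffs R (V i) Bf).
Proof.
suff [G GP] : exists G : 'M[R]_(n_ i, D), bounded_coeffs (V i) Bf G.
  by rewrite /coeffs; case: xgetP => [y -> //|/(_ G)].
have [_ [C [C1 CE]]] := span_rowsP R (V i).
have [_ [C' [C'1 C'E]]] := span_rowsP R (all_rows B).
pose Ci : 'M[R]_D := \matrix_j row (enum_rank (i, j)) C'.
exists (C *m Ci); split=> [k j|].
  rewrite mxE; apply: le_trans (ler_norm_sum _ _ _) _.
  rewrite -[D in leRHS]card_ord -sum1_card natr_sum.
  apply: ler_sum => l _; rewrite normrM -[leRHS]mulr1 ler_pM //.
  by rewrite mxE [X in `|X|]mxE.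
rewrite CE -mulmxA; congr (_ *m _); apply/row_matrixP => j.
rewrite row_mul rowK -row_mul -C'E -!map_row rowK enum_rankK.
by [].
Qed.

(** Consequently the basis entries are short enough to be sent, and each residual coordinate is zero
    or, up to sign, a single term of the cost. *)
Lemma basis_row j : row j Bf = 0 \/ exists i k, row j Bf = row k (V i).
Proof.
have [/(_ j)[->|[k ->]] _] := span_rowsP R (all_rows B); first by left.
rewrite rowK; set i := (_.1); set l := (_.2).
have [/(_ l)[->|[k' ->]] _] := span_rowsP R (V i); first by left.
by right; exists i, k'.
Qed.

End TwoLevelBasis.

(** * Message format and the protocol *)

Definition imsg (D p : nat) : finType := {ffun 'I_D -> 'I_(2 ^ p.+1)}.

Definition imsg_enc (D p : nat) (a : 'I_D -> int) : imsg D p :=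
  [ffun j => insubd (Ordinal (expn_gt0 2 p.+1)) (absz (a j + 2 ^+ p))].

Definition imsg_dec (D p : nat) (m : imsg D p) (j : 'I_D) : int :=
  (m j)%:Z - 2 ^+ p.

Lemma imsg_encK (D p : nat) (a : 'I_D -> int) :
  (forall j, `|a j| < 2 ^+ p) -> imsg_dec (imsg_enc p a) = a.
Proof.
move=> ap; apply: funext => j; rewrite /imsg_dec ffunE.
have := ap j; rewrite ltr_norml => /andP[lo hi].
have a0 : 0 <= a j + 2 ^+ p by rewrite -lerBlDr sub0r ltW.
rewrite insubdK; first by rewrite gez0_abs // addrK.
rewrite -topredE /= -ltz_nat gez0_abs // -natz natrX exprS mulr_natl mulr2n.
by rewrite ltrD2r.
Qed.

Lemma card_imsg (D p : nat) : #|imsg D p| = (2 ^ (p.+1 * D))%N.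
Proof. by rewrite card_ffun !card_ord expnM. Qed.

Section RegressionProtocol.
Variables (R : realType) (s d L q : nat) (n_ : 'I_s -> nat).
Local Notation D := (d + 1)%N.
(** [L] bits suffice for the input entries, and [8 * q + 9] for the sums of replies, which are below
    [512 * h ^ 8]. *)
Definition msg_bits : nat := (L + 8 * q + 9)%N.
(** [d + 1] queries per halving of at most [2 ^ ((7 * q + 7) * D)] cells, with one halving to
    spare. *)
Definition num_queries : nat := (d.+1 * ((7 * q + 7) * D).+1)%N.
Local Notation msg := (imsg D msg_bits).
Let m0 : msg := imsg_enc msg_bits (fun=> 0).
Let delta : R := (256 * (2 ^+ q) ^+ 6)^-1.

Definition basisU (B : 'M[int]_D) : 'M[R]_(D, d) := map_mx intr (lsubmx B).
Definition basisv (B : 'M[int]_D) : 'cV[R]_D := map_mx intr (rsubmx B).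

Definition hom_mx (i : 'I_s) (y : server_input n_ d i) : 'M[int]_(n_ i, D) :=
  row_mx y.1 y.2.

Definition response (i : 'I_s) (y : server_input n_ d i) (B : 'M[int]_D)
    (c : 'cV[R]_d) (j : 'I_D) : int :=
  Num.floor (sign_comb (coeffs R (hom_mx y) B)
               (map_mx intr y.1 *m c - map_mx intr y.2) j / delta).

Definition next_query (B : 'M[int]_D) (ms : seq ('I_D -> int)) : 'cV[R]_d :=
  query (basisU B) (basisv B) q ms.

Definition heard_basis (bs : seq msg) : 'M[int]_D :=
  \matrix_(k, j) imsg_dec (nth m0 bs (D + k)) j.

(** The sum of the replies of round [2 * D + k] is broadcast at the start of the next round, hence
    the successor. *)
Definition heard_sums (bs : seq msg) : seq ('I_D -> int) :=
  mkseq (fun k => imsg_dec (nth m0 bs (2 * D + k.+1))) ((size bs).-1 - 2 * D).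

Definition mx_row_msg (B : 'M[int]_D) (t : nat) (j : 'I_D) : int :=
  if insub t is Some k then B k j else 0.

(* Rounds [t < D] transmit the basis of a server, the broadcasts of the rounds
   [D <= t < 2 * D] the common basis, and round [2 * D + k] answers query [k]. *)
Definition server_msg (i : 'I_s) (y : server_input n_ d i) (bs : seq msg) : msg :=
  let t := (size bs).-1 in
  imsg_enc msg_bits
    (if (t < D)%N then mx_row_msg (span_rows R (hom_mx y)) t
     else response y (heard_basis bs) (next_query (heard_basis bs) (heard_sums bs))).

Definition coord_basis (tr : seq ('I_s -> msg)) : 'M[int]_D :=
  span_rows R (all_rows (fun i =>
    \matrix_(k, j) imsg_dec (nth (fun=> m0) tr k i) j)).

Definition round_sum (tr : seq ('I_s -> msg)) (t : nat) (j : 'I_D) : int :=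
  \sum_i imsg_dec (nth (fun=> m0) tr t i) j.

(** The servers ignore the broadcasts before round [D]. That of round [2 * D] is zero: all rows have
    been sent and no reply has been received. *)
Definition coord_msg (tr : seq ('I_s -> msg)) : msg :=
  imsg_enc msg_bits
    (if (size tr <= 2 * D)%N then mx_row_msg (coord_basis tr) (size tr - D)
     else round_sum tr (size tr).-1).

Definition coord_answer (tr : seq ('I_s -> msg)) : 'cV[R]_d :=
  answer (basisU (coord_basis tr)) (basisv (coord_basis tr)) q
    (mkseq (fun t => round_sum tr (2 * D + t)) num_queries).

Section Correctness.
Variables (x : forall i, server_input n_ d i) (eps : R).
Variables (b : nat -> msg) (m : nat -> 'I_s -> msg).
Let h : R := 2 ^+ q.
Hypothesis x_Lbit : Lbit_inputs L x.
Hypothesis bE : forall t, b t = coord_msg (mkseq m t).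
Hypothesis mE : forall t i, m t i = server_msg (x i) (mkseq b t.+1).
Hypothesis eps01 : 0 < eps <= 1.
Hypothesis eps_h : 1 <= eps * h.
Hypothesis D_h : D%:R <= h.
Hypothesis s_h : s%:R <= h.
Hypothesis n_h : (\sum_i n_ i)%:R <= h.

Let B := span_rows R (all_rows (fun i => span_rows R (hom_mx (x i)))).

Let h1 : 1 <= h. Proof. by rewrite /h exprn_ege1 // ler1n. Qed.
Let h0 : 0 < h. Proof. exact: lt_le_trans h1. Qed.

Lemma hom_mx_small i k j : `|hom_mx (x i) k j| < 2 ^+ msg_bits.
Proof.
have [Ai bi] := x_Lbit i.
apply: (@lt_le_trans _ _ (2 ^+ L)); last by rewrite ler_eXn2l // /msg_bits -addnA leq_addr.
by rewrite mxE; case: (fintype.split j) => l; [exact: Ai|rewrite ord1; exact: bi].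
Qed.

Lemma span_small i k j : `|span_rows R (hom_mx (x i)) k j| < 2 ^+ msg_bits.
Proof.
have [/(_ k) r _] := span_rowsP R (hom_mx (x i)).
have -> : span_rows R (hom_mx (x i)) k j = row k (span_rows R (hom_mx (x i))) 0 j.
  by rewrite [RHS]mxE.
case: r => [->|[l ->]]; rewrite mxE; last exact: hom_mx_small.
by rewrite normr0 exprn_gt0.
Qed.

Lemma basis_small k j : `|B k j| < 2 ^+ msg_bits.
Proof.
have -> : B k j = row k B 0 j by rewrite [RHS]mxE.
have [->|[i [l ->]]] := basis_row R (fun i => hom_mx (x i)) k; rewrite mxE.
  by rewrite normr0 exprn_gt0.
exact: hom_mx_small.
Qed.

Lemma coord_basisE t : (D <= t)%N -> coord_basis (mkseq m t) = B.
Proof.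
move=> Dt; rewrite /coord_basis /B; congr (span_rows R (all_rows _)); apply: funext => i.
apply/matrixP => k j; rewrite mxE nth_mkseq ?(leq_trans _ Dt) //.
rewrite mE /server_msg size_mkseq /= ltn_ord /mx_row_msg valK imsg_encK // => j'.
exact: span_small.
Qed.

Lemma heard_basisE t : (2 * D <= t)%N -> heard_basis (mkseq b t) = B.
Proof.
move=> Dt; apply/matrixP => k j; rewrite mxE.
have kD : (D + k < t)%N by apply: leq_trans Dt; rewrite mul2n -addnn ltn_add2l.
rewrite nth_mkseq // bE /coord_msg size_mkseq.
rewrite ifT; last by rewrite mul2n -addnn leq_add2l ltnW.
rewrite addKn /mx_row_msg valK coord_basisE ?leq_addr // imsg_encK // => j'.
exact: basis_small.
Qed.

Let ms (t : nat) : 'I_D -> int := imsg_dec (b (2 * D + t.+1)).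
Let c t := next_query B (mkseq ms t).

Lemma response_bound i t j :
  `|(response (x i) B (c t) j)%:~R| <= (n_ i)%:R * h * (256 * h ^+ 6) + 1 :> R.
Proof.
have [GD _] := coeffsP R (fun i => hom_mx (x i)) i.
rewrite /response; set g := sign_comb _ _ _.
have gb : `|g| <= (n_ i)%:R * h.
  by apply: le_trans (sign_comb_bound _ _ _ GD) _; rewrite ?ler_wpM2l.
have /andP[f1 f2] := real_floor_itv (num_real (g / delta)).
have : `|g / delta| <= (n_ i)%:R * h * (256 * h ^+ 6).
  rewrite /delta invrK normrM (gtr0_norm (precision_gt0 h0)).
  by apply: ler_wpM2r gb; exact: ltW (precision_gt0 h0).
move: f2; rewrite intrD !ler_norml => f2 /andP[g1 g2].
by apply/andP; split; lra.
Qed.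

(** An arbitrary set of servers covers both a single reply and the broadcast total. The bound
    [256 * h ^ 8 + h] includes one unit per server for the floors. *)
Lemma response_sum_bound (P : pred 'I_s) t j :
  `|\sum_(i | P i) response (x i) B (c t) j| < 2 ^+ msg_bits.
Proof.
rewrite -(ltr_int R) intr_norm rmorphXn rmorph_sum /=.
apply: le_lt_trans (ler_norm_sum _ _ _) _.
apply: (@le_lt_trans _ _ (\sum_i ((n_ i)%:R * h * (256 * h ^+ 6) + 1))).
  rewrite big_mkcond; apply: ler_sum => i _; case: ifP => _.
    exact: response_bound.
  apply: addr_ge0; last exact: ler01.
  apply: mulr_ge0; last exact: ltW (precision_gt0 h0).
  by rewrite mulr_ge0 // ltW.
rewrite big_split /= -!mulr_suml -natr_sum sumr_const card_ord.
apply: (@lt_le_trans _ _ (512 * h ^+ 8)); last first.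
  have -> : 512 * h ^+ 8 = 2 ^+ (8 * q + 9) :> R.
    by rewrite exprD mulrC /h -exprM mulnC; congr (_ * _); rewrite -natrX.
  by rewrite ler_eXn2l ?ltr1n // /msg_bits -addnA leq_addl.
have h8 : h <= h ^+ 8 by rewrite -[leLHS]expr1 ler_weXn2l.
apply: (@le_lt_trans _ _ (h * h * (256 * h ^+ 6) + h)).
  apply: lerD => //; apply: ler_wpM2r; first exact: ltW (precision_gt0 h0).
  by rewrite ler_wpM2r // ltW.
have -> : h * h * (256 * h ^+ 6) = 256 * h ^+ 8 by ring.
by move: h0 h8; lra.
Qed.

Lemma msg_response t i : imsg_dec (m (2 * D + t) i) = response (x i) B (c t).
Proof.
rewrite mE /server_msg size_mkseq /= ifF; last first.
  by apply/negbTE; rewrite -leqNgt mul2n -addnn -addnA leq_addr.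
rewrite heard_basisE; last by rewrite ltnW // ltnS leq_addr.
have -> : heard_sums (mkseq b (2 * D + t).+1) = mkseq ms t.
  rewrite /heard_sums size_mkseq /= addKn; apply/eq_in_map => k.
  rewrite mem_iota add0n => /andP[_ kt]; rewrite nth_mkseq // addnS ltnS.
  by rewrite -addnS leq_add2l.
rewrite imsg_encK // => j.
by have := response_sum_bound (pred1 i) t j; rewrite big_pred1_eq.
Qed.

Lemma ms_response t j : ms t j = \sum_i response (x i) B (c t) j.
Proof.
rewrite /ms bE /coord_msg size_mkseq ifF; last first.
  by apply/negbTE; rewrite -ltnNge -[X in (X < _)%N]addn0 ltn_add2l.
have sE : round_sum (mkseq m (2 * D + t.+1)) (2 * D + t.+1).-1 =
    fun j => \sum_i response (x i) B (c t) j.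
  apply: funext => j'; rewrite /round_sum [(_ + t.+1)%N]addnS /= nth_mkseq //.
  by apply: eq_bigr => i _; rewrite msg_response.
rewrite imsg_encK sE // => j'; exact: response_sum_bound.
Qed.

Lemma coord_answer_approx :
  l1_approx_solution (stackA R x) (stackb R x) eps
    (coord_answer (mkseq m (2 * D + num_queries))).
Proof.
rewrite /l1_approx_solution l1norm_stack.
rewrite (_ : (fun x' => _) = fun x' => \sum_i l1norm
    (map_mx intr (x i).1 *m x' - map_mx intr (x i).2)); last first.
  by apply: funext => y; exact: l1norm_stack.
rewrite /coord_answer coord_basisE; last first.
  by apply: leq_trans (leq_addr _ _); rewrite leq_pmull.
have -> : mkseq (fun t => round_sum (mkseq m (2 * D + num_queries)) (2 * D + t))
    num_queries = mkseq ms num_queries.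
  apply/eq_in_map => k; rewrite mem_iota add0n => /andP[_ kt].
  apply: funext => j; rewrite ms_response /round_sum nth_mkseq ?ltn_add2l //.
  by apply: eq_bigr => i _; rewrite msg_response.
have GP i := coeffsP R (fun i => hom_mx (x i)) i.
have BE : map_mx intr B = row_mx (basisU B) (basisv B) :> 'M[R]_D.
  by rewrite -map_row_mx hsubmxK.
have split i : map_mx intr (x i).1 = coeffs R (hom_mx (x i)) B *m basisU B /\
    map_mx intr (x i).2 = coeffs R (hom_mx (x i)) B *m basisv B.
  apply: eq_row_mx; rewrite -mul_mx_row -BE -map_row_mx.
  by have [_] := GP i.
have residE y j : resid (basisU B) (basisv B) y j 0 =
    \sum_l (B j (lshift 1 l))%:~R * y l 0 - (B j (rshift d 0))%:~R.
  by rewrite !mxE; congr (_ - _); apply: eq_bigr => l _; rewrite !mxE.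
apply: (answer_regression (G := fun i => coeffs R (hom_mx (x i)) B)) => //.
- by move=> i; have [] := split i.
- by move=> i; have [] := split i.
- by move=> i; have [] := GP i.
- move=> y j; rewrite residE.
  have [r0|[i [k rk]]] := basis_row R (fun i => hom_mx (x i)) j.
    have {}r0 l : B j l = 0 by move/rowP/(_ l): r0; rewrite !mxE.
    rewrite r0 big1 ?subr0 ?normr0 => [|l _]; last by rewrite r0 mul0r.
    by apply: sumr_ge0 => i _; exact: l1norm_ge0.
  have {}rk l : B j l = hom_mx (x i) k l by move/rowP/(_ l): rk; rewrite !mxE.
  rewrite (bigD1 i) //= /l1norm (bigD1 k) //= -addrA.
  apply: ler_wpDr.
    by rewrite addr_ge0 ?sumr_ge0 // => i' _; apply: sumr_ge0.
  rewrite rk row_mxEr !mxE le_eqVlt; apply/orP; left; apply/eqP.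
  congr (`|_ - _|); apply: eq_bigr => l _.
  by rewrite rk row_mxEl mxE.
- by move=> t j tn; rewrite ms_response.
Qed.

End Correctness.
End RegressionProtocol.

(** * Choice of the precision and communication count *)

Lemma pow2_bound (R : realType) (y : R) : 1 <= y ->
  exists q : nat, y <= 2 ^+ q /\ q%:R <= 1 + 2 * ln y.
Proof.
move=> y1; have y0 : 0 < y by exact: lt_le_trans y1.
(* Equivalent to [expR (- (1 / 2)) >= 1 / 2], an instance of [1 + x <= expR x]. *)
have ln2 : 1 / 2 <= ln 2 :> R.
  rewrite -ler_expR lnK ?posrE // -[expR _]invrK -expRN invf_ple ?posrE ?expR_gt0 //.
  by apply: le_trans (expR_ge1Dx _); lra.
have ex : exists n, y <= 2 ^+ n.
  have [n yn] : exists n : nat, y <= n%:R.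
    by exists (Num.bound y); apply/ltW/archi_boundP/ltW.
  by exists n; apply: le_trans yn _; rewrite -natrX ler_nat ltnW // ltn_expl.
case: (ex_minnP ex) => q yq qmin; exists q; split=> //.
have lny : 0 <= ln y by rewrite ln_ge0.
case: q yq qmin => [|k] _ kmin; first by lra.
(* Minimality of the exponent gives the logarithmic upper bound. *)
have : 2 ^+ k < y by rewrite ltNge; apply/negP => /kmin; rewrite ltnn.
move=> /ltW; rewrite -ler_ln ?posrE ?exprn_gt0 // lnXn // -[leLHS]mulr_natl.
rewrite -natr1 => /(le_trans (ler_wpM2l (ler0n R k) ln2)).
by lra.
Qed.

Theorem theorem7p5 (R : realType) :
  exists polylog : {poly R},
  forall (s d L : nat) (n_ : 'I_s -> nat) (eps : R),
    (0 < s)%N -> (0 < d)%N -> (0 < L)%N -> (0 < \sum_i n_ i)%N ->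
    0 < eps <= 1 ->
  exists (P : protocol (server_input n_ d) 'cV[R]_d) (T : nat),
    T%:R <= (s * d ^ 3 * L)%:R / eps
            * polylog.[ln ((s * (\sum_i n_ i) * d * L)%:R / eps)] /\
    forall x : forall i, server_input n_ d i, Lbit_inputs L x ->
      uses_bits P x T /\
      2 / 3 <= output_prob R P x T
                 (l1_approx_solution (stackA R x) (stackb R x) eps).
Proof.
(* [cst] is kept opaque: conversion would unfold the unary numeral. *)
have [cst cstE] : exists cst : nat, cst = 4712%N by exists 4712%N.
(* The number of rounds and the message length are each linear in [q], which is at most
   [3 + 2 * ln La]; the constant is [2 * 62 * 38]. *)
exists (cst%:R%:P * (3%:P + 2%:P * 'X) ^+ 2) => s d L n_ eps s0 d0 L0 n0 eps01.
have [e0 e1] := andP eps01.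
set N := (s * (\sum_i n_ i) * d * L)%N.
have N0 : (0 < N)%N by rewrite !muln_gt0 s0 n0 d0.
set La : R := N%:R / eps.
have NLa : N%:R <= La by rewrite ler_pdivlMr // ler_piMr.
have La1 : 1 <= La by apply: le_trans NLa; rewrite ler1n.
(* The factor 2 leaves room for [d + 1] below [2 ^ q] and makes [q] positive. *)
have [q [hq qle]] := @pow2_bound R (2 * La) ltac:(lra).
have q0 : (0 < q)%N.
  by case: q hq {qle} => // ; rewrite expr0; lra.
pose W := ((msg_bits L q).+1 * (d + 1))%N.
pose K := (2 * (d + 1) + num_queries d q)%N.
have W0 : (0 < W)%N by rewrite muln_gt0 addn1.
have le_h (a : nat) : (a <= 2 * N)%N -> a%:R <= 2 ^+ q :> R.
  move=> aN; apply: le_trans hq; apply: (@le_trans _ _ (2 * N%:R)).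
    by rewrite -natrM ler_nat.
  by rewrite ler_pM2l.
have [P PP] := @round_protocol s (server_input n_ d) 'cV[R]_d
  (imsg (d + 1) (msg_bits L q))
  W K (imsg_enc _ (fun=> 0)) (@server_msg R s d L q n_) (@coord_msg R s d L q)
  (@coord_answer R s d L q) s0 W0 ltac:(by rewrite card_imsg).
exists P, (2 * K * W * s)%N; split.
  have TE : (2 * K * W * s <= cst * (s * d ^ 3 * L) * q ^ 2)%N.
    rewrite cstE; have W1 : (W <= 38 * L * q * d)%N by rewrite /W /msg_bits; nia.
    have K1 : (K <= 62 * d ^ 2 * q)%N.
      have dd : ((d + 1) <= 2 * d)%N by lia.
      have K2 : (num_queries d q <= 58 * d ^ 2 * q)%N.
        rewrite /num_queries -addn1; apply: (@leq_trans ((2 * d) * (29 * d * q))).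
          by apply: leq_mul => //; nia.
        by nia.
      by rewrite /K; nia.
    apply: (@leq_trans (2 * (62 * d ^ 2 * q) * (38 * L * q * d) * s)).
      by do 2!apply: leq_mul => //; rewrite leq_mul2l.
    by rewrite !expnS !expn0; nia.
  apply: (@le_trans _ _ ((cst * (s * d ^ 3 * L) * q ^ 2)%:R)); first by rewrite ler_nat.
  have qX : q%:R <= 3 + 2 * ln La.
    have : ln 2 <= 1 :> R by apply: le_trans (le_ln1Dx (x := 1) _) _ => //; lra.
    move: qle; rewrite lnM ?posrE //; last exact: lt_le_trans La1.
    by lra.
  have a0 : 0 <= (s * d ^ 3 * L)%:R :> R by [].
  have -> : (cst%:R%:P * (3%:P + 2%:P * 'X) ^+ 2).[ln La] =
      cst%:R * (3 + 2 * ln La) ^+ 2 by rewrite !hornerE.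
  move: (s * d ^ 3 * L)%N a0 => a a0.
  have -> : (cst * a * q ^ 2)%:R = a%:R * (cst%:R * q%:R ^+ 2) :> R.
    by rewrite !natrM; ring.
  rewrite -[leRHS]mulrA; apply: ler_wpM2l => //.
  have q2 : q%:R ^+ 2 <= (3 + 2 * ln La) ^+ 2 by rewrite lerXn2r ?nnegrE // (le_trans _ qX).
  (* The factor [1 / eps] is at least 1. *)
  rewrite -[leLHS]mul1r; apply: ler_pM; rewrite ?mulr_ge0 ?exprn_ge0 //.
    by rewrite -[1]invr1 lef_pV2 ?posrE.
  exact: ler_wpM2l.
move=> x xL; have [b [m [bE mE runE]]] := PP x; split.
  by apply/forallP => w; rewrite runE.
have good : l1_approx_solution (stackA R x) (stackb R x) eps
    (coord_answer R (mkseq m K)).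
  apply: coord_answer_approx bE mE _ _ _ _ _ => //.
  - have : La * eps = N%:R by rewrite divfK // gt_eqF.
    have : 1 <= N%:R :> R by rewrite ler1n.
    by nra.
  - apply: le_h; rewrite mul2n -addnn leq_add // /N mulnAC leq_pmull //.
    by rewrite !muln_gt0 s0 n0.
  - apply: le_h; apply: leq_trans (leq_pmull _ _); rewrite // /N -!mulnA.
    by rewrite leq_pmulr // !muln_gt0 n0 d0.
  - apply: le_h; apply: leq_trans (leq_pmull _ _); rewrite // /N -!mulnA mulnCA.
    by rewrite leq_pmulr // !muln_gt0 s0 d0.
(* Every outcome of the coins is good, so the probability is 1. *)
rewrite /output_prob.
have -> : [set w : coin_space P | oapp (l1_approx_solution (stackA R x) (stackb R x) eps)
    false (run x w (2 * K * W * s))] = [set: coin_space P].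
  by apply/setP => w; rewrite !inE runE.
rewrite cardsT divff; first by lra.
rewrite pnatr_eq0 -lt0n; apply/card_gt0P.
by exists ([tuple of nseq (coins P) false], [ffun=> [tuple of nseq (coins P) false]]).
Qed.
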